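(* Let $\ell\ge 1$ and $n,m_1,\dots,m_\ell$ be positive integers, $m:=\sum_{i=1}^\ell m_i$. For $i=1,\dots,\ell$ let $C_i\subseteq\mathbb{R}^{m_i}$ be a nonempty closed convex set and $A_i\in\mathbb{R}^{m_i\times n}$ a nonzero matrix, and let $\bar v\in\mathbb{R}^n$, with $\bigcap_{i=1}^\ell A_i^{-1}C_i\neq\emptyset$. Let $x^*$ be the unique solution of $\min_x\frac12\|x-\bar v\|^2$ subject to $A_ix\in C_i$, $i=1,\dots,\ell$. Suppose: (i) each $C_i$ is a $C^{1,\alpha}$-cone reducible closed convex set, for some $\alpha\in(0,1]$; (ii) $\bigcap_{i=1}^\ell A_i^{-1}\operatorname{ri}C_i\neq\emptyset$; (iii) $0\in x^*-\bar v+\operatorname{ri}\partial\big(\sum_{i=1}^\ell\delta_{A_i^{-1}C_i}\big)(x^* )$. Let $d(\mathbf y):=\frac12\|\sum_{i=1}^\ell A_i^Ty_i-\bar v\|^2-\frac12\|\bar v\|^2+\sum_{i=1}^\ell\sigma_{C_i}(y_i)$ for $\mathbf y=(y_1,\dots,y_\ell)\in\mathbb{R}^m$, and $d^*:=\inf d$. Then there exist positive constants $\epsilon$ and $c$ such that $$\operatorname{dist}(\mathbf y,\operatorname{Argmin} d)\le c\,(d(\mathbf y)-d^* )^{1-\frac1{1+\alpha}}\quad\text{and}\quad(d(\mathbf y)-d^* )^{\frac1{1+\alpha}}\le c\,\operatorname{dist}(\mathbf 0,\partial d(\mathbf y))$$ whenever $\mathbf y\in Y_\epsilon:=\{\mathbf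 y:\operatorname{dist}(\mathbf y,\operatorname{Argmin} d)\le\epsilon,\ d^*\le d(\mathbf y)\le d^*+\epsilon\}$.
   Context: $A_i^{-1}S:=\{x:A_ix\in S\}$; $\operatorname{ri}$ is relative interior; $\delta_S$ is the indicator function of $S$; $\sigma_C(y)=\sup_{u\in C}\langle y,u\rangle$; $\partial$ is the convex subdifferential. $C^{1,\alpha}$-cone reducibility: a closed set $\mathfrak D\subseteq\mathbb{R}^k$ is $C^{1,\alpha}$-cone reducible at $\hat x\in\mathfrak D$ if there are $\rho>0$, a closed convex pointed cone $K$ in a finite-dimensional Hilbert space $\mathbb Y$ and a map $\Xi:\mathbb{R}^k\to\mathbb Y$ with $\Xi(\hat x)=0$, continuously differentiable on $B(\hat x,\rho)$, with $D\Xi(\hat x)$ surjective, $x\mapsto D\Xi(x)$ $\alpha$-Hölder continuous on $B(\hat x,\rho)$, and $\mathfrak D\cap B(\hat x,\rho)=\{x:\Xi(x)\in K\}\cap B(\hat x,\rho)$; it is $C^{1,\alpha}$-cone reducible if this holds at every point of $\mathfrak D$. *)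

(* Defs.v *)
From HB Require Import structures.
From mathcomp Require Import all_boot all_order all_algebra.
From mathcomp Require Import all_classical all_reals all_analysis.

Set Implicit Arguments.
Unset Strict Implicit.
Unset Printing Implicit Defensive.

Import Order.TTheory GRing.Theory Num.Theory.
Local Open Scope classical_set_scope.
Local Open Scope ring_scope.

Section Euclid.
Variable R : realType.

Definition dotv k (u w : 'cV[R]_k) : R := \sum_(j < k) u j 0 * w j 0.
Definition enorm k (u : 'cV[R]_k) : R := Num.sqrt (dotv u u).

Definition closed_e k (S : set 'cV[R]_k) : Prop :=
  forall x, (forall e, 0 < e -> exists y, S y /\ enorm (x - y) < e) -> S x.

Definition convex_e k (S : set 'cV[R]_k) : Prop :=
  forall x y t, S x -> S y -> 0 <= t -> t <= 1 -> S (t *: x + (1 - t) *: y).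

Definition affhull k (S : set 'cV[R]_k) : set 'cV[R]_k :=
  [set x | exists (p : nat) (pts : 'I_p -> 'cV[R]_k) (w : 'I_p -> R),
     (forall j, S (pts j)) /\ \sum_(j < p) w j = 1 /\ x = \sum_(j < p) w j *: pts j].

Definition ri k (S : set 'cV[R]_k) : set 'cV[R]_k :=
  [set x | S x /\ exists e, 0 < e /\
     forall z, affhull S z -> enorm (z - x) < e -> S z].

Definition preim k q (M : 'M[R]_(q, k)) (S : set 'cV[R]_q) : set 'cV[R]_k :=
  [set x | S (M *m x)].

Definition indic k (S : set 'cV[R]_k) (x : 'cV[R]_k) : \bar R :=
  if `[< S x >] then 0%E else +oo%E.

Definition supportf k (S : set 'cV[R]_k) (y : 'cV[R]_k) : \bar R :=
  ereal_sup [set (dotv y u)%:E | u in S].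

Definition subdiff k (f : 'cV[R]_k -> \bar R) (x : 'cV[R]_k) : set 'cV[R]_k :=
  [set g | f x \is a fin_num /\
     forall z, (f x + (dotv g (z - x))%:E <= f z)%E].

Definition has_fderiv k p (f : 'cV[R]_k -> 'cV[R]_p) (x : 'cV[R]_k) (J : 'M[R]_(p, k)) :=
  forall e, 0 < e -> exists d, 0 < d /\ forall h : 'cV[R]_k,
    enorm h < d -> enorm (f (x + h) - f x - J *m h) <= e * enorm h.

Definition is_cone p (K : set 'cV[R]_p) : Prop :=
  K 0 /\ forall x t, K x -> 0 <= t -> K (t *: x).

Definition pointed p (K : set 'cV[R]_p) : Prop :=
  forall x, K x -> K (- x) -> x = 0.

(* C^{1,alpha}-cone reducibility at xh (the finite-dimensional Hilbert space Y
   is taken to be R^p with the Euclidean structure) *)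
Definition C1a_reducible_at k (alpha : R) (D : set 'cV[R]_k) (xh : 'cV[R]_k) : Prop :=
  exists (rho : R) (p : nat) (K : set 'cV[R]_p)
         (Xi : 'cV[R]_k -> 'cV[R]_p) (DXi : 'cV[R]_k -> 'M[R]_(p, k)),
  0 < rho /\
      (closed_e K /\ convex_e K /\ is_cone K /\ pointed K) /\
      Xi xh = 0 /\
      (forall x, enorm (x - xh) < rho -> has_fderiv Xi x (DXi x)) /\
      (forall x, enorm (x - xh) < rho -> forall e, 0 < e -> exists d, 0 < d /\
         forall y, enorm (y - xh) < rho -> enorm (y - x) < d ->
         forall h, enorm ((DXi y - DXi x) *m h) <= e * enorm h) /\
      (forall z : 'cV[R]_p, exists h, DXi xh *m h = z) /\
      (exists L, 0 <= L /\ forall x y, enorm (x - xh) < rho -> enorm (y - xh) < rho ->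
         forall h, enorm ((DXi x - DXi y) *m h) <= L * powR (enorm (x - y)) alpha * enorm h) /\
      (forall x, enorm (x - xh) < rho -> (D x <-> K (Xi x))).

Definition C1a_reducible k (alpha : R) (D : set 'cV[R]_k) : Prop :=
  forall xh, D xh -> C1a_reducible_at alpha D xh.

Definition prodv (l : nat) (m : 'I_l -> nat) := forall i : 'I_l, 'cV[R]_(m i).

Definition pdot l (m : 'I_l -> nat) (y z : prodv m) : R := \sum_(i < l) dotv (y i) (z i).
Definition pnorm l (m : 'I_l -> nat) (y : prodv m) : R := Num.sqrt (pdot y y).
Definition psub l (m : 'I_l -> nat) (y z : prodv m) : prodv m := fun i => y i - z i.
Definition pzero l (m : 'I_l -> nat) : prodv m := fun i => 0.

Definition psubdiff l (m : 'I_l -> nat) (f : prodv m -> \bar R) (y : prodv m) : set (prodv m) :=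
  [set g | f y \is a fin_num /\
     forall z, (f y + (pdot g (psub z y))%:E <= f z)%E].

(* dist(y, S) in the product space, extended-valued (+oo if S is empty) *)
Definition pdist l (m : 'I_l -> nat) (y : prodv m) (S : set (prodv m)) : \bar R :=
  ereal_inf [set (pnorm (psub y z))%:E | z in S].

Definition Findic l n (m : 'I_l -> nat) (A : forall i : 'I_l, 'M[R]_(m i, n))
  (C : forall i : 'I_l, set 'cV[R]_(m i)) (x : 'cV[R]_n) : \bar R :=
  (\sum_(i < l) indic (preim (A i) (C i)) x)%E.

Definition dfun l n (m : 'I_l -> nat) (A : forall i : 'I_l, 'M[R]_(m i, n))
  (C : forall i : 'I_l, set 'cV[R]_(m i)) (v : 'cV[R]_n) (y : prodv m) : \bar R :=
  (((1/2) * enorm (\sum_(i < l) (A i)^T *m y i - v) ^+ 2 - (1/2) * enorm v ^+ 2)%:E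
   + \sum_(i < l) supportf (C i) (y i))%E.

Definition dstar l (m : 'I_l -> nat) (d : prodv m -> \bar R) : \bar R :=
  ereal_inf (range d).

Definition argmin l (m : 'I_l -> nat) (d : prodv m -> \bar R) : set (prodv m) :=
  [set y | d y = dstar d].

End Euclid.

(* Main.v *)
(** The dual solutions are the points y of the cone N = N_C(A x* ) with A^T y = v - x*, and
    d(y) - d* = |A^T y - (v - x* )|^2 / 2 + sup_(c in C) <y, c - A x*>, where all blocks are
    stacked into one vector.  Three facts combine.  First, cone reducibility lets one follow
    every small tangent vector h of C up to an error |h|^(1 + alpha) (a Newton iteration);
    testing the supremum along the projection of y on the tangent cone gives
    dist(y, N) <= O((d(y) - d* )^(alpha / (1 + alpha))) for bounded y.  Second, (ii) and (iii)
    put a point of the relative interior of N in the affine space A^T y = v - x*, so the two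
    sets are linearly regular on bounded sets.  Third, (ii) makes the set of dual solutions
    bounded modulo the subspace of directions along which d is constant, so bounded y
    suffice.  The second inequality follows from the first by convexity of d. *)
Require Import Defs.
From HB Require Import structures.
From mathcomp Require Import all_boot all_order all_algebra.
From mathcomp Require Import all_classical all_reals all_analysis.
From mathcomp Require Import ring lra.
Set Implicit Arguments.
Unset Strict Implicit.
Unset Printing Implicit Defensive.
Import Order.TTheory GRing.Theory Num.Theory.
Import numFieldNormedType.Exports.
Local Open Scope classical_set_scope.
Local Open Scope ring_scope.

(** * Euclidean space *)

(** Write g = v - x* and E for the gap between d(y) and its infimum. The chain rule for normal cones
    is obtained only up to closure: a normal of the feasible set is a limit of vectors A^T y with y
    normal to C. The slack provided by (iii) repairs this: the approximation error is absorbed into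
    nonnegative coefficients on normals that span the normal cone, and the existence of a dual
    solution comes out of the same argument. Relative interiors are handled in coordinates: a
    spanning family taken inside the set, a ball of admissible coefficients, and preimages under a
    matrix with a linear norm bound. The exponent alpha / (1 + alpha) stems from the support term;
    the residual |A^T y - g| is of order E^(1/2), which is absorbed because alpha <= 1. *)

Section EuclideanSpace.
Variable R : realType.
Implicit Types (k p : nat) (t e : R).

Lemma dotvC k (x y : 'cV[R]_k) : dotv x y = dotv y x.
Proof. by rewrite /dotv; apply: eq_bigr => j _; rewrite mulrC. Qed.

Lemma dotvDl k (x y z : 'cV[R]_k) : dotv (x + y) z = dotv x z + dotv y z.
Proof.
by rewrite /dotv -big_split; apply: eq_bigr => j _; rewrite mxE mulrDl.
Qed.

Lemma dotvZl k t (x z : 'cV[R]_k) : dotv (t *: x) z = t * dotv x z.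
Proof. by rewrite /dotv mulr_sumr; apply: eq_bigr => j _; rewrite mxE -mulrA. Qed.

Lemma dotvNl k (x z : 'cV[R]_k) : dotv (- x) z = - dotv x z.
Proof. by rewrite -scaleN1r dotvZl mulN1r. Qed.

Lemma dotvDr k (x y z : 'cV[R]_k) : dotv z (x + y) = dotv z x + dotv z y.
Proof. by rewrite dotvC dotvDl !(dotvC z). Qed.

Lemma dotvZr k t (x z : 'cV[R]_k) : dotv z (t *: x) = t * dotv z x.
Proof. by rewrite dotvC dotvZl (dotvC z). Qed.

Lemma dotvNr k (x z : 'cV[R]_k) : dotv z (- x) = - dotv z x.
Proof. by rewrite dotvC dotvNl (dotvC z). Qed.

Lemma dotvBl k (x y z : 'cV[R]_k) : dotv (x - y) z = dotv x z - dotv y z.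
Proof. by rewrite dotvDl dotvNl. Qed.

Lemma dotvBr k (x y z : 'cV[R]_k) : dotv z (x - y) = dotv z x - dotv z y.
Proof. by rewrite dotvDr dotvNr. Qed.

Lemma dotv0l k (x : 'cV[R]_k) : dotv 0 x = 0.
Proof. by rewrite -(scale0r 0) dotvZl mul0r. Qed.

Lemma dotv0r k (x : 'cV[R]_k) : dotv x 0 = 0.
Proof. by rewrite dotvC dotv0l. Qed.

Definition dotvE := (dotvDl, dotvDr, dotvNl, dotvNr, dotvZl, dotvZr, dotv0l, dotv0r).

Lemma dotv_ge0 k (x : 'cV[R]_k) : 0 <= dotv x x.
Proof. by apply: sumr_ge0 => j _; rewrite -expr2 sqr_ge0. Qed.

Lemma dotv_mulmx k p (B : 'M[R]_(p, k)) (x : 'cV[R]_k) (y : 'cV[R]_p) :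
  dotv (B *m x) y = dotv x (B^T *m y).
Proof.
transitivity (((B *m x)^T *m y) 0 0).
  by rewrite [RHS]mxE; apply: eq_bigr => j _; rewrite [in RHS]mxE.
by rewrite trmx_mul -mulmxA [LHS]mxE; apply: eq_bigr => j _; rewrite [in LHS]mxE.
Qed.

Lemma enorm_ge0 k (x : 'cV[R]_k) : 0 <= enorm x.
Proof. exact: sqrtr_ge0. Qed.
Hint Resolve enorm_ge0 : core.

Lemma enorm_sqr k (x : 'cV[R]_k) : enorm x ^+ 2 = dotv x x.
Proof. by rewrite sqr_sqrtr // dotv_ge0. Qed.

Lemma enormZ k t (x : 'cV[R]_k) : enorm (t *: x) = `|t| * enorm x.
Proof.
by rewrite /enorm dotvZl dotvZr mulrA -expr2 sqrtrM ?sqr_ge0 // sqrtr_sqr.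
Qed.

Lemma enormN k (x : 'cV[R]_k) : enorm (- x) = enorm x.
Proof. by rewrite /enorm dotvNl dotvNr opprK. Qed.

Lemma enorm_distC k (x y : 'cV[R]_k) : enorm (x - y) = enorm (y - x).
Proof. by rewrite -enormN opprB. Qed.

Lemma enorm0 k : enorm (0 : 'cV[R]_k) = 0.
Proof. by rewrite /enorm dotv0l sqrtr0. Qed.

Lemma enorm_eq0 k (x : 'cV[R]_k) : enorm x = 0 -> x = 0.
Proof.
move=> x0; have : dotv x x = 0 by rewrite -enorm_sqr x0 expr0n.
move/psumr_eq0P => h; apply/matrixP => i j; rewrite (ord1 j) mxE.
have /eqP : x i 0 * x i 0 = 0 by apply: h => // a _; rewrite -expr2 sqr_ge0.
by rewrite mulf_eq0 orbb => /eqP.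
Qed.

Lemma enorm_gt0 k (x : 'cV[R]_k) : x != 0 -> 0 < enorm x.
Proof.
move=> x0; rewrite lt0r enorm_ge0 andbT.
by apply: contraNneq x0 => /enorm_eq0 ->.
Qed.

Lemma cauchy_schwarz k (x y : 'cV[R]_k) : `|dotv x y| <= enorm x * enorm y.
Proof.
have [->|y0] := eqVneq y 0; first by rewrite dotv0r enorm0 mulr0 normr0.
have ny : 0 < enorm y by exact: enorm_gt0.
rewrite -ler_sqr ?nnegrE ?mulr_ge0 //.
rewrite real_normK ?num_real // exprMn !enorm_sqr.
have yy : 0 < dotv y y by rewrite -enorm_sqr exprn_gt0.
have := dotv_ge0 (dotv y y *: x - dotv x y *: y).
have -> : dotv (dotv y y *: x - dotv x y *: y) (dotv y y *: x - dotv x y *: y)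
  = dotv y y * (dotv x x * dotv y y - dotv x y ^+ 2).
  by rewrite !dotvE (dotvC y x); ring.
by rewrite pmulr_rge0 // subr_ge0.
Qed.

Lemma dotv_le_enorm k (x y : 'cV[R]_k) : dotv x y <= enorm x * enorm y.
Proof. exact: le_trans (ler_norm _) (cauchy_schwarz x y). Qed.

Lemma enormD k (x y : 'cV[R]_k) : enorm (x + y) <= enorm x + enorm y.
Proof.
rewrite -ler_sqr ?nnegrE ?addr_ge0 // enorm_sqr sqrrD !enorm_sqr !dotvE (dotvC y x).
have := dotv_le_enorm x y; lra.
Qed.

Lemma enormB k (x y : 'cV[R]_k) : enorm (x - y) <= enorm x + enorm y.
Proof. by rewrite (le_trans (enormD _ _)) // enormN. Qed.

Lemma enorm_triangle k (x y z : 'cV[R]_k) :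
  enorm (x - z) <= enorm (x - y) + enorm (y - z).
Proof. by rewrite (le_trans _ (enormD _ _)) // addrA subrK. Qed.

Lemma coord_le_enorm k (x : 'cV[R]_k) i : `|x i 0| <= enorm x.
Proof.
rewrite -ler_sqr ?nnegrE // real_normK ?num_real // enorm_sqr /dotv (bigD1 i) //=.
by rewrite -expr2 lerDl sumr_ge0 // => j _; rewrite -expr2 sqr_ge0.
Qed.

Lemma enorm_sum k (I : Type) (r : seq I) (P : pred I) (F : I -> 'cV[R]_k) :
  enorm (\sum_(i <- r | P i) F i) <= \sum_(i <- r | P i) enorm (F i).
Proof.
elim/big_rec2 : _ => [|i x y _ h]; first by rewrite enorm0.
by rewrite (le_trans (enormD _ _)) // lerD2l.
Qed.

Lemma mulmx_sum_col k p (B : 'M[R]_(p, k)) (x : 'cV[R]_k) :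
  B *m x = \sum_j x j 0 *: col j B.
Proof.
apply/matrixP => i j; rewrite (ord1 j) mxE summxE; apply: eq_bigr => a _.
by rewrite !mxE mulrC.
Qed.

Lemma enorm_col1 k (i : 'I_k) : enorm (col i (1%:M : 'M[R]_k)) = 1.
Proof.
rewrite /enorm /dotv (bigD1 i) //= big1 ?addr0 => [|j ji]; rewrite !mxE.
  by rewrite eqxx mulr1 sqrtr1.
by rewrite (negPf ji) mulr0.
Qed.

Lemma enorm_le_coord k (x : 'cV[R]_k) b :
  (forall i, `|x i 0| <= b) -> enorm x <= k%:R * b.
Proof.
move=> h; rewrite -[x]mul1mx mulmx_sum_col (le_trans (enorm_sum _ _ _)) //.
rewrite (le_trans (y := \sum_(i < k) b)) //; last first.
  by rewrite sumr_const card_ord mulr_natl.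
apply: ler_sum => i _; rewrite enormZ.
by rewrite enorm_col1 mulr1 h.
Qed.

Lemma mulmx_bounded k p (B : 'M[R]_(p, k)) :
  exists M, 0 < M /\ forall x : 'cV[R]_k, enorm (B *m x) <= M * enorm x.
Proof.
have s0 : 0 <= \sum_j enorm (col j B) by apply: sumr_ge0.
exists (1 + \sum_j enorm (col j B)); split; first lra.
move=> x; rewrite mulmx_sum_col (le_trans (enorm_sum _ _ _)) //.
rewrite mulrDl mul1r ler_wpDl // big_distrl /=; apply: ler_sum => j _.
by rewrite enormZ mulrC ler_wpM2l // coord_le_enorm.
Qed.

(** A generalized inverse yields a preimage that is linear in [B *m x], hence bounded by it. *)
Lemma bounded_preimage k p (B : 'M[R]_(p, k)) :
  exists M, 0 < M /\ forall x : 'cV[R]_k, exists x' : 'cV[R]_k,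
    B *m x' = B *m x /\ enorm x' <= M * enorm (B *m x).
Proof.
have := @mulmxKpV R 1 _ _ ^~ B^T; move: (pinvmx B^T) => P hP.
have [M [M0 hM]] := mulmx_bounded P^T.
exists M; split => // x; exists (P^T *m (B *m x)); split; last exact: hM.
by apply: trmx_inj; rewrite !trmx_mul trmxK hP // submxMl.
Qed.

Lemma surjective_right_inverse k p (J : 'M[R]_(p, k)) :
  (forall z : 'cV[R]_p, exists h, J *m h = z) -> exists G : 'M[R]_(k, p), J *m G = 1%:M.
Proof.
move=> /choice[f hf]; exists (\matrix_(i, j) (f (col j 1%:M)) i 0).
apply/matrixP => i j; have := hf (col j 1%:M).
move=> /matrixP /(_ i 0); rewrite [RHS]mxE => <-; rewrite !mxE.
by apply: eq_bigr => a _; rewrite mxE.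
Qed.

(** Take columns from [S] of maximal rank: appending another element of [S] cannot raise the rank.
    That the columns belong to [S] matters later, when they are normals or shifted points of [C]. *)
Lemma spanning_subfamily k (S : set 'cV[R]_k) :
  exists p (U : 'M[R]_(k, p)), (forall j, S (col j U)) /\
    forall x, S x -> exists b, x = U *m b.
Proof.
pose P r := `[< exists p (U : 'M[R]_(k, p)), (forall j, S (col j U)) /\ \rank U = r >].
have exP : exists r, P r.
  by exists 0%N; apply/asboolP; exists 0%N, 0; split; [case|rewrite mxrank0].
have bP r : P r -> (r <= k)%N by move=> /asboolP[p [U [_ <-]]]; exact: rank_leq_row.
case: (ex_maxnP exP bP) => r /asboolP[p [U [SU rU]]] rmax.
exists p, U; split => // x Sx.
have [/submxP[D xD]|xU] := boolP (x^T <= U^T)%MS.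
  by exists D^T; rewrite -[x]trmxK xD trmx_mul trmxK.
have : P (\rank (row_mx U x)).
  apply/asboolP; exists (p + 1)%N, (row_mx U x); split => // j.
  case: (split_ordP j) => a ->.
    by rewrite colKl; exact: SU.
  by rewrite colKr (ord1 a) col_id.
move/rmax; rewrite -rU -mxrank_tr tr_row_mx -(mxrank_tr U) => le_rk.
have := mxrank_leqif_sup (_ : (U^T <= col_mx U^T x^T)%MS).
rewrite -addsmxE addsmxSl => /(_ isT) [le1]; rewrite eqn_leq le1 /=.
rewrite le_rk => /esym.
by rewrite col_mx_sub (negPf xU) andbF.
Qed.

(** The range is the kernel of [W^T], where [W] is built from a generalized inverse of [U^T]; the
    norm bound on [W^T] makes this kernel closed. *)
Lemma range_closed k p (U : 'M[R]_(k, p)) : closed_e [set x | exists b, x = U *m b].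
Proof.
move=> x hx.
have := @mulmxKpV R 1 _ _ ^~ U^T; move: (pinvmx U^T) => P hP.
pose W := 1%:M - P *m U^T.
have WU (b : 'cV_p) : W^T *m (U *m b) = 0.
  apply: trmx_inj; rewrite !trmx_mul trmxK trmx0 /W mulmxBr mulmx1.
  by rewrite [X in _ - X]mulmxA hP ?subrr // submxMl.
have [M [M0 hM]] := mulmx_bounded W^T.
have Wx : W^T *m x = 0.
  apply: enorm_eq0; apply/le_anti; rewrite enorm_ge0 andbT.
  apply/ler_addgt0Pr => e e0; rewrite add0r.
  have [y [[b ->] yx]] := hx (e / M) (divr_gt0 e0 M0).
  rewrite -(subr0 (W^T *m x)) -(WU b) -mulmxBr (le_trans (hM _)) //.
  by rewrite mulrC -ler_pdivlMr // ltW.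
exists (P^T *m x).
move: Wx; rewrite /W linearB /= trmx1 trmx_mul trmxK mulmxBl mul1mx -mulmxA.
by move/eqP; rewrite subr_eq0 => /eqP.
Qed.

Lemma euclid_complete k (u : nat -> 'cV[R]_k) :
  (forall e, 0 < e -> exists n0, forall i j, (n0 <= i)%N -> (n0 <= j)%N ->
     enorm (u i - u j) < e) ->
  exists x, forall e, 0 < e -> exists n0, forall i, (n0 <= i)%N -> enorm (u i - x) < e.
Proof.
move=> hu.
have hc a : cvgn (fun i => u i a 0).
  apply: cauchy_cvg; apply/cauchy_ballP => e e0.
  have [n0 hn] := hu e e0.
  exists ((fun i => u i a 0) @` [set i | (n0 <= i)%N], (fun i => u i a 0) @` [set i | (n0 <= i)%N]).
    by split; exists n0 => // i /= ni; exists i.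
  move=> [_ _] /= [[i ni <-] [j nj <-]]; rewrite /ball /=.
  rewrite (le_lt_trans _ (hn i j ni nj)) //.
  by have := coord_le_enorm (u i - u j) a; rewrite !mxE.
exists (\col_a limn (fun i => u i a 0)) => e e0.
have k0 : 0 < (k.+1%:R : R) by rewrite ltr0n.
(* Dividing by [k.+1] covers dimension 0 and makes the final bound strict. *)
have e'0 : 0 < e / k.+1%:R by rewrite divr_gt0.
have hnear : \forall i \near \oo, forall a, `|u i a 0 - limn (fun i => u i a 0)| < e / k.+1%:R.
  apply: filter_forall => a.
  have /cvgrPdist_lt /(_ _ e'0) := hc a.
  by apply: filterS => i; rewrite distrC.
case: hnear => n0 _ hn; exists n0 => i /hn {}hn.
rewrite (@le_lt_trans _ _ (k%:R * (e / k.+1%:R))) //.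
  by apply: enorm_le_coord => a; rewrite !mxE ltW // hn.
rewrite mulrCA -[ltRHS]mulr1 ltr_pM2l // ltr_pdivrMr // mul1r ltr_nat //.
Qed.

End EuclideanSpace.
#[export] Hint Extern 0 (is_true (_ <= enorm _)) => exact: enorm_ge0 : core.

(** * Projections and cone reducibility *)

Section Projection.
Variable R : realType.
Implicit Types (k p : nat) (t e : R).

Lemma small_natSinv e : 0 < e -> exists j : nat, j.+1%:R^-1 < e.
Proof. by move=> /ltr_add_invr[j]; rewrite add0r; exists j. Qed.

(** The midpoint is spelled with weights [2^-1] and [1 - 2^-1] to match [convex_e]. *)
Lemma parallelogram k (x y z : 'cV[R]_k) :
  enorm (x - y) ^+ 2 = 2 * enorm (z - x) ^+ 2 + 2 * enorm (z - y) ^+ 2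
    - 4 * enorm (z - (2^-1 *: x + (1 - 2^-1) *: y)) ^+ 2.
Proof.
have -> : (1 - 2^-1 : R) = 2^-1 by lra.
rewrite !enorm_sqr !dotvE (dotvC x z) (dotvC y z) (dotvC y x).
by field.
Qed.

(** Midpoints stay in [T], so the parallelogram identity makes a minimizing sequence Cauchy;
    completeness stands in for compactness. *)
Lemma closest_point k (T : set 'cV[R]_k) (y : 'cV[R]_k) :
  closed_e T -> convex_e T -> T !=set0 ->
  exists2 t, T t & forall z, T z -> enorm (y - t) <= enorm (y - z).
Proof.
move=> Tcl Tcv [z0 Tz0].
pose D := [set enorm (y - z) | z in T].
have D0 : D !=set0 by exists (enorm (y - z0)), z0.
have Dlb : has_lbound D by exists 0 => _ [z _ <-].
have Dinf : has_inf D by split.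
set dl := inf D.
have dl0 : 0 <= dl by apply: lb_le_inf => // _ [z _ <-].
have dlle z : T z -> dl <= enorm (y - z) by move=> Tz; apply: ge_inf => //; exists z.
have /choice[u hu] : forall j : nat, exists z, T z /\ enorm (y - z) < dl + j.+1%:R^-1.
  move=> j; have j0 : 0 < j.+1%:R^-1 :> R by rewrite invr_gt0.
  by have [_ [z Tz <-] lt] := inf_adherent j0 Dinf; exists z.
have [|t ht] := @euclid_complete R k u.
  move=> e e0.
  (* For errors x <= 1 the squared distance is at most 4 (dl + x)^2 - 4 dl^2 <= (8 dl + 4) x, which
     this threshold keeps below e^2. *)
  have [j hj] : exists j : nat, j.+1%:R^-1 < Num.min 1 (e ^+ 2 / (8 * dl + 5)).
    apply: small_natSinv; rewrite lt_min ltr01 /= divr_gt0 ?exprn_gt0 //; lra.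
  exists j => a b ja jb; rewrite -ltr_sqr ?nnegrE ?enorm_ge0 // ?ltW //.
  rewrite (parallelogram _ _ y).
  have [Ta la] := hu a; have [Tb lb] := hu b.
  have /dlle lm : T (2^-1 *: u a + (1 - 2^-1) *: u b) by apply: Tcv => //; lra.
  move: hj; rewrite lt_min => /andP[]; set x := j.+1%:R^-1 => x1.
  rewrite ltr_pdivlMr; last lra.
  have x0 : 0 < x by rewrite invr_gt0.
  have {}la : enorm (y - u a) <= dl + x.
    by rewrite (le_trans (ltW la)) // lerD2l lef_pV2 ?posrE // ler_nat ltnS.
  have {}lb : enorm (y - u b) <= dl + x.
    by rewrite (le_trans (ltW lb)) // lerD2l lef_pV2 ?posrE // ler_nat ltnS.
  have sa : enorm (y - u a) ^+ 2 <= (dl + x) ^+ 2.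
    by rewrite ler_sqr ?nnegrE ?enorm_ge0 //; lra.
  have sb : enorm (y - u b) ^+ 2 <= (dl + x) ^+ 2.
    by rewrite ler_sqr ?nnegrE ?enorm_ge0 //; lra.
  have sm : dl ^+ 2 <= enorm (y - (2^-1 *: u a + (1 - 2^-1) *: u b)) ^+ 2.
    by rewrite ler_sqr ?nnegrE ?enorm_ge0.
  have xx : x ^+ 2 <= x by rewrite expr2 -[leRHS]mulr1 ler_wpM2l // ltW.
  move: sa sb sm xx; rewrite sqrrD; lra.
have Tt : T t.
  apply: Tcl => e e0; have [j hj] := ht e e0; exists (u j); split; first by case: (hu j).
  by rewrite enorm_distC hj.
exists t => // z /dlle; apply: le_trans; apply/ler_addgt0Pr => e e0.
have e20 : 0 < e / 2 by lra.
have [j1 hj1] := ht _ e20; have [j2 hj2] := small_natSinv e20.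
pose j := maxn j1 j2.
have {}hj1 := hj1 j (leq_maxl _ _); have [_ hj] := hu j.
have jj : j.+1%:R^-1 <= j2.+1%:R^-1 :> R.
  by rewrite lef_pV2 ?posrE // ler_nat ltnS leq_maxr.
move: hj2 hj jj; set x1 := j2.+1%:R^-1; set x2 := j.+1%:R^-1 => hj2 hj jj.
have := enorm_triangle y (u j) t; lra.
Qed.

Lemma variational_projection k (T : set 'cV[R]_k) (y : 'cV[R]_k) :
  closed_e T -> convex_e T -> T !=set0 ->
  exists2 t, T t & forall z, T z -> dotv (y - t) (z - t) <= 0.
Proof.
move=> Tcl Tcv T0; have [t Tt tmin] := closest_point y Tcl Tcv T0.
exists t => // z Tz; rewrite leNgt; apply/negP.
set a := dotv _ _ => a0; set b := dotv (z - t) (z - t).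
have b0 : 0 <= b by exact: dotv_ge0.
(* This step satisfies s <= 1 and s b < a, so the first-order gain 2 s a outweighs s^2 b and [t]
   would not be closest. *)
pose s := a / (a + b + 1).
have s0 : 0 < s by rewrite divr_gt0 //; lra.
have s1 : s <= 1 by rewrite ler_pdivrMr; lra.
have sE : s * (a + b + 1) = a by rewrite mulfVK // gt_eqF //; lra.
have /tmin := Tcv z t s Tz Tt (ltW s0) s1.
rewrite -ler_sqr ?nnegrE // !enorm_sqr.
have -> : y - (s *: z + (1 - s) *: t) = (y - t) - s *: (z - t).
  by apply/matrixP => i j; rewrite !mxE; ring.
have -> : dotv (y - t - s *: (z - t)) (y - t - s *: (z - t))
    = dotv (y - t) (y - t) - 2 * s * a + s * (s * b).
  rewrite /a /b; move: (y - t) (z - t) => x w.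
  by rewrite !dotvE (dotvC w x); ring.
move=> h.
have : s * (2 * a) <= s * (s * b) by lra.
rewrite ler_pM2l //; have : 0 < s * (a + 1) by rewrite mulr_gt0 //; lra.
lra.
Qed.

(** Moreau decomposition: testing the variational inequality at [2 *: t] and at 0 gives the
    orthogonality, and the inequality then says that [y - t] is polar to [T]. *)
Lemma cone_projection k (T : set 'cV[R]_k) (y : 'cV[R]_k) :
  closed_e T -> convex_e T -> is_cone T ->
  exists t : 'cV[R]_k, T t /\ dotv (y - t) t = 0 /\ forall z, T z -> dotv (y - t) z <= 0.
Proof.
move=> Tcl Tcv [T0 Tc].
have [|t Tt ht] := variational_projection y Tcl Tcv; first by exists 0.
have tt : dotv (y - t) t = 0.
  apply/le_anti/andP; split.
    by have := ht (2 *: t) (Tc _ _ Tt (ler0n _ _)); rewrite dotvBr dotvZr; lra.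
  by have := ht 0 T0; rewrite dotvBr dotv0r; lra.
by exists t; split=> //; split=> // z /ht; rewrite dotvBr tt subr0.
Qed.

End Projection.

(** * Newton correction and tangential approximation of reducible sets *)

Section Reducibility.
Variable R : realType.
Implicit Types (k p : nat) (t e : R).

(** Pairing with the error vector [w] itself reduces this to the scalar mean value theorem: |w|^2
    becomes the pairing of [w] with (D - J) u at an intermediate point, and Cauchy-Schwarz cancels
    one factor |w|. *)
Lemma mean_value_estimate k p (f : 'cV[R]_k -> 'cV[R]_p) (D : 'cV[R]_k -> 'M[R]_(p, k))
    (J : 'M[R]_(p, k)) (a b : 'cV[R]_k) eta :
  (forall t, 0 <= t <= 1 -> has_fderiv f (b + t *: (a - b)) (D (b + t *: (a - b)))) ->
  (forall t, 0 <= t <= 1 ->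
     enorm ((D (b + t *: (a - b)) - J) *m (a - b)) <= eta * enorm (a - b)) ->
  enorm (f a - f b - J *m (a - b)) <= eta * enorm (a - b).
Proof.
move=> hD hJ; set u := a - b in hD hJ *; set w := f a - f b - J *m u.
pose phi t := dotv w (f (b + t *: u) - t *: (J *m u)).
pose dphi t := dotv w (D (b + t *: u) *m u - J *m u).
have der t : 0 <= t <= 1 -> is_derive (t : R) 1 (phi : R -> R) (dphi t).
  move=> t01.
  have cv : (fun h : R => h^-1 *: (phi (h *: 1 + t) - phi t)) @ 0^' --> dphi t.
    apply/cvgrPdist_le => e e0.
    have W0 : 0 < (enorm w + 1) * (enorm u + 1).
      by rewrite mulr_gt0 // ltr_wpDl.
    have [d [d0 hd]] := hD t t01 _ (divr_gt0 e0 W0).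
    have d'0 : 0 < d / (enorm u + 1) by rewrite divr_gt0 // ltr_wpDl.
    near=> h.
    have h0 : h != 0 by near: h; exact: nbhs_dnbhs_neq.
    have hn0 : 0 < `|h| by rewrite normr_gt0.
    have hd' : `|h| < d / (enorm u + 1).
      near: h; apply: dnbhs0_lt => //.
    have hu : enorm (h *: u) < d.
      rewrite enormZ; move: hd'; rewrite ltr_pdivlMr ?ltr_wpDl // => hd'.
      by rewrite (le_lt_trans _ hd') // ler_wpM2l // lerDl.
    have := hd _ hu; set y := b + t *: u => hy.
    have E : phi (h *: 1 + t) - phi t - h * dphi t
        = dotv w (f (y + h *: u) - f y - D y *m (h *: u)).
      have -> : h *: 1 = h :> R by exact: mulr1.
      rewrite /phi /dphi -/y.
      have -> : b + (h + t) *: u = y + h *: u by rewrite /y scalerDl addrA addrAC.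
      by rewrite -scalemxAr !dotvE; ring.
    have -> : dphi t - h^-1 *: (phi (h *: 1 + t) - phi t)
      = - (h^-1 * (phi (h *: 1 + t) - phi t - h * dphi t)).
      by rewrite /GRing.scale /=; field.
    rewrite normrN normrM normfV ler_pdivrMl // E.
    rewrite (le_trans (cauchy_schwarz _ _)) //.
    rewrite (le_trans (ler_wpM2l (enorm_ge0 _) hy)) // enormZ.
    have -> : enorm w * (e / ((enorm w + 1) * (enorm u + 1)) * (`|h| * enorm u))
      = (`|h| * e) * ((enorm w * enorm u) / ((enorm w + 1) * (enorm u + 1))) by ring.
    rewrite -[leRHS]mulr1 ler_wpM2l ?mulr_ge0 // ?ltW // ltr_pdivrMr // mul1r.
    have := enorm_ge0 w; have := enorm_ge0 u; set x1 := enorm u; set x2 := enorm w.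
    by move=> p1 p2; rewrite mulrDl mulrDr; lra.
  apply: DeriveDef; first by apply/cvg_ex; exists (dphi t).
  by rewrite /derive; apply: cvg_lim.
have [||c c01] := @MVT R phi dphi 0 1 ltr01.
- move=> t /[!in_itv] /= /andP[t0 t1]; apply: der; lra.
- apply: derivable_within_continuous => t /[!in_itv] /= t01.
  by case: (der t t01).
have {}c01 : 0 <= c <= 1 by move: c01 => /[!in_itv] /=; lra.
rewrite subr0 mulr1 {1 2}/phi scale1r scale0r addr0 !scale0r scale1r subr0.
have -> : b + u = a by rewrite /u addrC subrK.
rewrite -dotvBr addrAC -/w /dphi -mulmxBl => E.
have [w0|w0] := eqVneq w 0.
  by rewrite w0 enorm0 (le_trans _ (hJ c c01)).
have w0' := enorm_gt0 w0.
rewrite -(ler_pM2l w0') -expr2 enorm_sqr E.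
rewrite (le_trans (dotv_le_enorm _ _)) // ler_wpM2l //; exact: hJ.
Unshelve. all: by end_near.
Qed.

(** Banach iteration from 0: with factor 1/2 the iterates stay within 2 |F 0| <= r, where the
    contraction bound holds. The size of the fixed point becomes the size of the Newton
    correction. *)
Lemma contraction_fixpoint p (F : 'cV[R]_p -> 'cV[R]_p) r :
  2 * enorm (F 0) <= r ->
  (forall u w, enorm u <= r -> enorm w <= r ->
     enorm (F u - F w) <= 2^-1 * enorm (u - w)) ->
  exists2 u, F u = u & enorm u <= 2 * enorm (F 0).
Proof.
set b := enorm (F 0) => br hF.
pose u j := iter j F 0.
have b0 : 0 <= b by exact: enorm_ge0.
have q0 j : 0 < 2^-1 ^+ j :> R by rewrite exprn_gt0 // invr_gt0.
(* The factor 1 - 2^-j sharpens the bound 2 b so that the induction closes. *)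
have step j : enorm (u j) <= 2 * b * (1 - 2^-1 ^+ j) /\
    enorm (u j.+1 - u j) <= b * 2^-1 ^+ j.
  elim: j => [|j [h1 h2]].
    by rewrite /u /= enorm0 expr0 subrr mulr0 subr0 mulr1.
  have h3 : enorm (u j.+1) <= 2 * b * (1 - 2^-1 ^+ j.+1).
    have := enormD (u j.+1 - u j) (u j); rewrite subrK exprS.
    by move=> h; rewrite (le_trans h) // (le_trans (lerD h2 h1)) //; lra.
  have le2b i : 2 * b * (1 - 2^-1 ^+ i) <= r.
    have : 0 <= b * 2^-1 ^+ i by rewrite mulr_ge0 // ltW.
    lra.
  split => //; rewrite [u j.+2]iterS [X in _ - X]iterS.
  rewrite (le_trans (hF _ _ _ _)) ?(le_trans h3) ?(le_trans h1) //.
  by rewrite exprS mulrCA ler_pM2l.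
have dist i d : enorm (u (i + d)%N - u i) <= 2 * b * (2^-1 ^+ i - 2^-1 ^+ (i + d)).
  elim: d => [|d IH]; first by rewrite addn0 !subrr enorm0 mulr0.
  have := enorm_triangle (u (i + d.+1)%N) (u (i + d)%N) (u i).
  have [_] := step (i + d)%N; rewrite addnS exprS; lra.
have small e : 0 < e -> exists j : nat, 2 * b * 2^-1 ^+ j < e.
  move=> e0; have e'0 : 0 < e / (2 * b + 1) by rewrite divr_gt0 //; lra.
  have [j hj] := small_natSinv e'0; exists j.
  have le : 2^-1 ^+ j <= j.+1%:R^-1 :> R.
    rewrite exprVn -natrX lef_pV2 ?posrE ?ltr0n ?expn_gt0 // ler_nat.
    exact: ltn_expl.
  move: hj; rewrite ltr_pdivlMr; last lra.
  apply: le_lt_trans; rewrite mulrC.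
  by apply: ler_pM => //; rewrite ?(ltW (q0 _)) ?mulr_ge0 //; lra.
have mono i j : (i <= j)%N -> 2 * b * 2^-1 ^+ j <= 2 * b * 2^-1 ^+ i.
  move=> ij; apply: ler_wpM2l; first by rewrite mulr_ge0.
  by apply: ler_wiXn2l => //; lra.
have distle i j : (i <= j)%N -> enorm (u j - u i) <= 2 * b * 2^-1 ^+ i.
  move=> ij; have := dist i (j - i)%N; rewrite subnKC //.
  have : 0 <= 2 * b * 2^-1 ^+ j by rewrite !mulr_ge0 // ltW.
  lra.
have [|x hx] := @euclid_complete R p u.
  move=> e e0; have [j hj] := small _ (divr_gt0 e0 (ltr0n _ 2)).
  exists j => i i' ji ji'.
  have [d1 d2] := (distle _ _ ji, distle _ _ ji').
  have := enorm_triangle (u i) (u j) (u i'); rewrite (enorm_distC (u j)); lra.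
have ub j : enorm (u j) <= 2 * b.
  case: (step j) => h _; have : 0 <= 2 * b * 2^-1 ^+ j by rewrite !mulr_ge0 // ltW.
  lra.
have xb : enorm x <= 2 * b.
  apply/ler_addgt0Pr => e e0; have [j hj] := hx e e0.
  have := hj j (leqnn _); have := ub j.
  have := enorm_triangle x (u j) 0; rewrite !subr0 (enorm_distC x); lra.
exists x => //; apply/eqP; rewrite -subr_eq0; apply/eqP/enorm_eq0/le_anti.
rewrite enorm_ge0 andbT; apply/ler_addgt0Pr => e e0; rewrite add0r.
have [j hj] := hx _ (divr_gt0 e0 (ltr0n _ 2)).
have h1 := hj j (leqnn _); have h2 := hj j.+1 (leqnSn _).
have := hF x (u j) (le_trans xb br) (le_trans (ub j) br).
rewrite (enorm_distC x) => h3.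
have := enorm_triangle (F x) (F (u j)) x; rewrite -[F (u j)]/(u j.+1) in h3 *; lra.
Qed.

Lemma cone_of_linear_preimage k p (J : 'M[R]_(p, k)) (K : set 'cV[R]_p) :
  closed_e K -> convex_e K -> is_cone K ->
  [/\ closed_e (Defs.preim J K), convex_e (Defs.preim J K) & is_cone (Defs.preim J K)].
Proof.
move=> Kcl Kcv [K0 Kc]; split.
- move=> x hx; have [M [M0 hM]] := mulmx_bounded J.
  apply: Kcl => e e0; have [y [Ky xy]] := hx _ (divr_gt0 e0 M0).
  exists (J *m y); split => //; rewrite -mulmxBr (le_lt_trans (hM _)) //.
  by rewrite mulrC -ltr_pdivlMr.
- move=> x y t Kx Ky t0 t1; rewrite /Defs.preim /= mulmxDr -!scalemxAr.
  exact: Kcv.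
- split=> [|x t Kx t0]; rewrite /Defs.preim /= ?mulmx0 // -scalemxAr.
  exact: Kc.
Qed.

(* The difference quotients of [Xi] along the segment from [xb] to [c] lie in [K]. *)
Lemma feasible_direction_in_tangent_cone k p (C : set 'cV[R]_k) (K : set 'cV[R]_p)
    (Xi : 'cV[R]_k -> 'cV[R]_p) (J : 'M[R]_(p, k)) (xb : 'cV[R]_k) rho :
  convex_e C -> C xb -> closed_e K -> is_cone K -> 0 < rho ->
  (forall x, enorm (x - xb) < rho -> C x -> K (Xi x)) ->
  Xi xb = 0 -> has_fderiv Xi xb J ->
  forall c, C c -> Defs.preim J K (c - xb).
Proof.
move=> Ccv Cxb Kcl [_ Kc] rho0 hK Xi0 hJ c Cc; rewrite /Defs.preim /=.
set u := c - xb; apply: Kcl => e e0.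
have u1 : 0 < enorm u + 1 by rewrite ltr_wpDl.
have [d [d0 hd]] := hJ _ (divr_gt0 e0 u1).
pose t := Num.min 1 (Num.min rho d / (enorm u + 1)).
have t0 : 0 < t by rewrite lt_min ltr01 divr_gt0 // lt_min rho0.
have t1 : t <= 1 by rewrite ge_min lexx.
have tu : enorm (t *: u) < Num.min rho d.
  rewrite enormZ gtr0_norm //.
  have : t * (enorm u + 1) <= Num.min rho d by rewrite -ler_pdivlMr // ge_min lexx orbT.
  lra.
move: tu; rewrite lt_min => /andP[tr td].
exists (t^-1 *: Xi (xb + t *: u)); split.
  apply: Kc; last by rewrite invr_ge0 ltW.
  apply: hK; first by rewrite addrAC subrr add0r.
  have -> : xb + t *: u = t *: c + (1 - t) *: xb.
    by rewrite /u; apply/matrixP => i j; rewrite !mxE; ring.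
  by apply: Ccv => //; exact: ltW.
have := hd _ td; rewrite Xi0 subr0 => h.
have -> : J *m u - t^-1 *: Xi (xb + t *: u)
    = - (t^-1 *: (Xi (xb + t *: u) - J *m (t *: u))).
  rewrite -scalemxAr (scalerBr t^-1) scalerA mulVf ?gt_eqF // scale1r opprB //.
rewrite enormN enormZ gtr0_norm ?invr_gt0 // mulrC ltr_pdivrMr //.
rewrite (le_lt_trans h) // enormZ gtr0_norm // mulrCA mulrC ltr_pM2r //.
by rewrite mulrAC ltr_pdivrMr // ltr_pM2l // ltrDl.
Qed.

(* The correction [x - xb - h] is found by the simplified Newton iteration for
   [Xi x = J h] along a right inverse [G] of [J]. *)
Lemma reducible_tangent_approximation k (C : set 'cV[R]_k) (xb : 'cV[R]_k) alpha :
  convex_e C -> C xb -> 0 < alpha -> C1a_reducible_at alpha C xb ->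
  exists (T : set 'cV[R]_k) s0 M,
    [/\ closed_e T, convex_e T & is_cone T] /\
    (forall c, C c -> T (c - xb)) /\ 0 < s0 /\ 0 < M /\
    forall h, T h -> enorm h <= s0 ->
      exists2 x, C x & enorm (x - xb - h) <= M * enorm h `^ (1 + alpha).
Proof.
move=> Ccv Cxb a0 [rho [p [K [Xi [DXi [rho0 [[Kcl [Kcv [Kc _]]] [Xi0 [hD [_ [Jsurj
  [[L [L0 hL]] hCK]]]]]]]]]]]].
set J := DXi xb in Jsurj *.
have xbxb : enorm (xb - xb) < rho by rewrite subrr enorm0.
have [G JG] := surjective_right_inverse Jsurj.
have [g [g0 hg]] := mulmx_bounded G.
pose L' := L + 1; have L'0 : 0 < L' by rewrite /L'; lra.
have [gp L'p] : 0 <= g /\ 0 <= L' by split; exact: ltW.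
have g20 : 0 < (2 * g * L')^-1 by rewrite invr_gt0 !mulr_gt0.
(* Within radius [r1] the derivative differs from [J] by at most 1 / (2 g), which will make the
   Newton map a contraction with factor 1/2; the term rho / 2 keeps the points in the ball where
   [Xi] is differentiable. *)
pose r1 := Num.min (rho / 2) ((2 * g * L')^-1 `^ alpha^-1).
have r10 : 0 < r1 by rewrite lt_min divr_gt0 //= powR_gt0.
have r1rho : r1 < rho.
  have : r1 <= rho / 2 by rewrite ge_min lexx.
  lra.
have r1a s : 0 <= s -> s <= r1 -> L' * s `^ alpha <= (2 * g)^-1.
  move=> sp sr.
  have : s `^ alpha <= (2 * g * L')^-1.
    have an0 : alpha != 0 by rewrite gt_eqF.
    have -> : (2 * g * L')^-1 = ((2 * g * L')^-1 `^ alpha^-1) `^ alpha.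
      by rewrite -powRrM mulVf // powRr1 // ltW.
    apply: ge0_ler_powR; rewrite ?nnegrE ?powR_ge0 //; first exact: ltW.
    by rewrite (le_trans sr) // ge_min lexx orbT.
  by rewrite invfM ler_pdivlMr // mulrC.
have near x : enorm (x - xb) <= r1 -> enorm (x - xb) < rho.
  by move=> /le_lt_trans; apply.
have est (a b : 'cV[R]_k) s : s <= r1 ->
    (forall t, 0 <= t <= 1 -> enorm (b + t *: (a - b) - xb) <= s) ->
    enorm (Xi a - Xi b - J *m (a - b)) <= L' * s `^ alpha * enorm (a - b).
  move=> sr hs; apply: (mean_value_estimate (D := DXi)) => t t01.
    by apply: hD; apply: near; rewrite (le_trans (hs t t01)).
  have hst := hs t t01.
  rewrite (le_trans (hL _ _ _ xbxb _)) //; first by apply: near; exact: le_trans sr.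
  rewrite ler_wpM2r //; apply: ler_pM => //; rewrite ?powR_ge0 /L' //; first lra.
  apply: ge0_ler_powR => //; rewrite ?nnegrE //; first exact: ltW.
  exact: le_trans hst.
(* The radius r1 / 2 leaves the other half of [r1] to the correction G u, and |G u| <= g * 2 |F 0|
   gives the constant. *)
exists (Defs.preim J K), (r1 / 2), (2 * g * L'); split; first exact: cone_of_linear_preimage.
split.
  apply: (feasible_direction_in_tangent_cone _ _ _ _ rho0 _ Xi0 (hD _ xbxb)) => //.
  by move=> x /hCK ->.
split; first by rewrite divr_gt0.
split; first by rewrite !mulr_gt0.
move=> h KJh hr.
have hr1 : enorm h <= r1 by lra.
pose y u : 'cV[R]_k := xb + h + G *m u.
(* At a fixed point Xi (y u) = J h, which lies in [K], so [y u] lies in [C]. As J G = 1, differences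
   of [F] are linearization errors of [Xi]. *)
pose F u := u - (Xi (y u) - J *m h).
have F0 : enorm (F 0) <= L' * enorm h `^ (1 + alpha).
  have -> : F 0 = - (Xi (xb + h) - Xi xb - J *m (xb + h - xb)).
    rewrite /F /y mulmx0 addr0 Xi0 subr0 add0r; congr (- (_ - _ *m _)).
    by rewrite addrAC subrr add0r.
  rewrite enormN (le_trans (est _ _ (enorm h) hr1 _)) //.
    move=> t /andP[t0 t1].
    have -> : xb + t *: (xb + h - xb) - xb = t *: h.
      by apply/matrixP => i j; rewrite !mxE; ring.
    by rewrite enormZ ger0_norm // ler_piMl.
  have -> : xb + h - xb = h by rewrite addrAC subrr add0r.
  rewrite -mulrA ler_wpM2l //.
  have [->|hn0] := eqVneq (enorm h) 0; first by rewrite mulr0 powR_ge0.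
  by rewrite addrC powRD ?hn0 ?implybT // powRr1.
have F0' : 2 * enorm (F 0) <= r1 / (2 * g).
  have := r1a _ (enorm_ge0 h) hr1 => hh.
  have {}F0 : enorm (F 0) <= (L' * enorm h `^ alpha) * enorm h.
    rewrite (le_trans F0) // -mulrA ler_wpM2l //.
    have [->|hn0] := eqVneq (enorm h) 0; first by rewrite powR0 ?mulr0 //; lra.
    by rewrite addrC powRD ?hn0 ?implybT // powRr1.
  have {}F0 : enorm (F 0) <= (2 * g)^-1 * (r1 / 2).
    rewrite (le_trans F0) //; apply: ler_pM => //.
    by rewrite mulr_ge0 ?powR_ge0 // ltW.
  lra.
have [|u Fu un] := @contraction_fixpoint p F (r1 / (2 * g)) F0'.
  move=> u w ur wr.
  have -> : F u - F w = - (Xi (y u) - Xi (y w) - J *m (y u - y w)).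
    have -> : y u - y w = G *m (u - w).
      by rewrite /y mulmxBr opprD addrACA subrr add0r.
    by rewrite mulmxA JG mul1mx /F; apply/matrixP => i j; rewrite !mxE; ring.
  have yuw : y u - y w = G *m (u - w).
    by rewrite /y mulmxBr opprD addrACA subrr add0r.
  rewrite enormN (le_trans (est _ _ r1 (lexx _) _)) //.
    move=> t /andP[t0 t1]; rewrite yuw.
    have -> : y w + t *: (G *m (u - w)) - xb = h + G *m (t *: u + (1 - t) *: w).
      rewrite mulmxBr (mulmxDr G (t *: u)) -!scalemxAr /y; move: (G *m u) (G *m w) => a b.
      by apply/matrixP => i j; rewrite !mxE; ring.
    rewrite (le_trans (enormD _ _)) //.
    have := hg (t *: u + (1 - t) *: w); have := enormD (t *: u) ((1 - t) *: w).
    rewrite !enormZ !ger0_norm ?subr_ge0 // => h1 h2.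
    have h3 : enorm (t *: u + (1 - t) *: w) <= r1 / (2 * g).
      rewrite (le_trans h1) //.
      have : t * enorm u <= t * (r1 / (2 * g)) by rewrite ler_wpM2l.
      have : (1 - t) * enorm w <= (1 - t) * (r1 / (2 * g)) by rewrite ler_wpM2l // subr_ge0.
      lra.
    have h4 : g * enorm (t *: u + (1 - t) *: w) <= r1 / 2.
      have -> : r1 / 2 = g * (r1 / (2 * g)) by field; rewrite gt_eqF.
      by rewrite ler_wpM2l // ltW.
    lra.
  rewrite yuw.
  have -> : 2^-1 * enorm (u - w) = (2 * g)^-1 * (g * enorm (u - w)).
    by field; rewrite gt_eqF.
  apply: ler_pM => //; first by rewrite mulr_ge0 ?powR_ge0 // ltW.
  by apply: r1a => //; exact: ltW.
have Xiu : Xi (y u) = J *m h.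
  by move: Fu => /eqP; rewrite /F subr_eq -subr_eq0 opprD addrA subrr add0r oppr_eq0
    subr_eq0 => /eqP.
have Gu : enorm (G *m u) <= 2 * g * L' * enorm h `^ (1 + alpha).
  rewrite (le_trans (hg _)) // (le_trans (ler_wpM2l (ltW g0) un)) //.
  have := ler_wpM2l (ltW g0) F0; lra.
exists (y u); last by have -> : y u - xb - h = G *m u
  by rewrite /y; move: (G *m u) => a; apply/matrixP => i j; rewrite !mxE; ring.
apply/hCK; last by rewrite Xiu.
apply: near; rewrite /y.
have -> : xb + h + G *m u - xb = h + G *m u.
  by move: (G *m u) => a; apply/matrixP => i j; rewrite !mxE; ring.
rewrite (le_trans (enormD _ _)) //.
have : enorm (G *m u) <= g * (r1 / (2 * g)).
  by rewrite (le_trans (hg _)) // ler_wpM2l // (le_trans un).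
have -> : g * (r1 / (2 * g)) = r1 / 2 by field; rewrite gt_eqF.
lra.
Qed.

End Reducibility.

(** * Relative interiors, duality and the error bound *)

Section AffineHull.
Variable R : realType.
Implicit Types (k p : nat) (t e : R).

(** The total weight [s] is left free: adding -t b and then t a to an affine combination passes
    through one that is not affine. *)
Lemma lincomb_cons k (S : set 'cV[R]_k) (s t : R) (z a : 'cV[R]_k) :
  (exists p (pts : 'I_p -> 'cV[R]_k) (w : 'I_p -> R),
    (forall j, S (pts j)) /\ \sum_(j < p) w j = s /\ z = \sum_(j < p) w j *: pts j) ->
  S a ->
  exists p (pts : 'I_p -> 'cV[R]_k) (w : 'I_p -> R),
    (forall j, S (pts j)) /\ \sum_(j < p) w j = t + s /\
    t *: a + z = \sum_(j < p) w j *: pts j.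
Proof.
move=> [p [pts [w [hS [hw hz]]]]] Sa.
exists p.+1, (fun j => oapp pts a (unlift ord0 j)), (fun j => oapp w t (unlift ord0 j)).
split; first by move=> j; case: unliftP => [i _|_] /=.
rewrite !big_ord_recl unlift_none /= -hw hz; split; congr (_ + _);
  by apply: eq_bigr => j _; rewrite liftK.
Qed.

Lemma affhull_translate k (S : set 'cV[R]_k) (z a b : 'cV[R]_k) t :
  affhull S z -> S a -> S b -> affhull S (z + t *: (a - b)).
Proof.
move=> hz Sa Sb; have := lincomb_cons t (lincomb_cons (- t) hz Sb) Sa.
have -> : t *: a + (- t *: b + z) = z + t *: (a - b).
  by apply/matrixP => i j; rewrite !mxE; ring.
by rewrite addrA subrr add0r.
Qed.

Lemma affhull_self k (S : set 'cV[R]_k) (z : 'cV[R]_k) : S z -> affhull S z.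
Proof.
move=> Sz; exists 1%N, (fun=> z), (fun=> 1).
by rewrite !big_ord1 scale1r.
Qed.

Lemma affhull_mulmx k p (S : set 'cV[R]_k) (x z : 'cV[R]_k) (U : 'M[R]_(k, p)) b :
  affhull S z -> S x -> (forall j, S (col j U + x)) -> affhull S (z + U *m b).
Proof.
move=> hz Sx SU; rewrite mulmx_sum_col.
elim: (index_enum _) => [|j r IH]; first by rewrite big_nil addr0.
rewrite big_cons addrCA addrC.
have -> : b j 0 *: col j U = b j 0 *: ((col j U + x) - x) by rewrite addrK.
exact: affhull_translate.
Qed.

(** Relative interiority in coordinates: the columns are differences of points of [S], so moving
    along them stays in the affine hull. *)
Lemma ri_margin k p (S : set 'cV[R]_k) (x z : 'cV[R]_k) (U : 'M[R]_(k, p)) :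
  ri S z -> S x -> (forall j, S (col j U + x)) ->
  exists2 r, 0 < r & forall b, enorm b <= r -> S (z + U *m b).
Proof.
move=> [Sz [e [e0 he]]] Sx SU.
have [M [M0 hM]] := mulmx_bounded U.
exists (e / (2 * M)); first by rewrite divr_gt0 // mulr_gt0.
move=> b hb; apply: he; first exact: affhull_mulmx (affhull_self Sz) Sx SU.
rewrite addrAC subrr add0r (le_lt_trans (hM _)) //.
have : M * enorm b <= M * (e / (2 * M)) by rewrite ler_wpM2l // ltW.
have -> : M * (e / (2 * M)) = e / 2 by field; rewrite gt_eqF.
lra.
Qed.

(** As [s] is a difference of points of [S], one may move from [z] a little against it. In this form
    the relative interior condition (iii) enters the duality argument. *)
Lemma ri_retract k (S : set 'cV[R]_k) (z s : 'cV[R]_k) :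
  ri S z -> S 0 -> S s -> exists2 mu, 0 < mu & S (z - mu *: s).
Proof.
move=> [Sz [e [e0 he]]] S0 Ss; have s1 : 0 < enorm s + 1 by rewrite ltr_wpDl.
pose mu := e / (enorm s + 1); have mu0 : 0 < mu by rewrite divr_gt0.
exists mu => //; apply: he.
  have -> : z - mu *: s = z + mu *: (0 - s) by rewrite sub0r scalerN.
  by apply: affhull_translate => //; exact: affhull_self.
rewrite addrAC subrr sub0r enormN enormZ gtr0_norm // /mu mulrAC ltr_pdivrMr //.
by rewrite ltr_pM2l // ltrDl.
Qed.

End AffineHull.

(** * Inversion of power growth *)

Section PowerEstimates.
Variable R : realType.
Implicit Types (a b c e : R).

Lemma holder_exponentE alpha : 0 < alpha ->
  1 - 1 / (1 + alpha) = alpha / (1 + alpha) :> R.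
Proof. by move=> a0; field; rewrite gt_eqF //; lra. Qed.

(** Since w / W <= 1 and 2 theta <= 1, w / W <= (w / W)^(2 theta): the a priori bound [W] trades the
    exponent 1/2 for [theta]. *)
Lemma half_square_le_powR (theta W w E : R) : 0 < theta -> theta <= 1 / 2 -> 0 < W ->
  0 <= w -> w <= W -> (1 / 2) * w ^+ 2 <= E ->
  w <= W * (2 / W ^+ 2) `^ theta * E `^ theta.
Proof.
move=> t0 t1 W0 w0 wW wE.
have [->|wn0] := eqVneq w 0; first by rewrite !mulr_ge0 ?powR_ge0 // ltW.
have {}w0 : 0 < w by rewrite lt0r wn0.
have q0 : 0 < w / W by rewrite divr_gt0.
have q1 : w / W <= 1 by rewrite ler_pdivrMr // mul1r.
have E0 : 0 <= E by apply: le_trans wE; rewrite mulr_ge0 ?sqr_ge0.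
have h1 : w / W <= (w / W) `^ (2%:R * theta).
  by apply: ger1_powR; rewrite ?q0 //; lra.
rewrite powRrM powR_mulrn ?(ltW q0) // in h1.
have h2 : ((w / W) ^+ 2) `^ theta <= (2 / W ^+ 2 * E) `^ theta.
  apply: ge0_ler_powR; rewrite ?nnegrE ?sqr_ge0 //; first exact: ltW.
    by rewrite mulr_ge0 // divr_ge0 // sqr_ge0.
  have -> : 2 / W ^+ 2 * E = (2 * E) / W ^+ 2 by ring.
  rewrite expr_div_n ler_pM2r ?invr_gt0 ?exprn_gt0 //; lra.
rewrite [X in _ <= X]powRM // ?divr_ge0 ?sqr_ge0 // in h2.
rewrite -mulrA mulrC -ler_pdivrMr //; exact: le_trans h1 h2.
Qed.

(** With b = a / D the hypothesis reads b^(1 + 1/alpha) <= 2 E / D, and alpha / (1 + alpha) is the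
    inverse of that exponent. *)
Lemma powR_growth_inverse (alpha D a E : R) : 0 < alpha -> 0 < D -> 0 <= a ->
  (a / D) `^ alpha^-1 * a <= 2 * E ->
  a <= D * (2 / D) `^ (alpha / (1 + alpha)) * E `^ (alpha / (1 + alpha)).
Proof.
move=> a0 D0 ap h.
set theta := alpha / (1 + alpha).
have th0 : 0 < theta by rewrite divr_gt0 //; lra.
pose b := a / D; have b0 : 0 <= b by rewrite divr_ge0 // ltW.
have aE : a = D * b by rewrite /b mulrC mulfVK // gt_eqF.
have E0 : 0 <= E.
  have : 0 <= (a / D) `^ alpha^-1 * a by rewrite mulr_ge0 ?powR_ge0.
  lra.
have h1 : b `^ (1 + alpha^-1) <= 2 / D * E.
  rewrite mulrAC ler_pdivlMr //; apply: le_trans h.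
  have [bz|bn0] := eqVneq b 0.
    rewrite -/b bz powR0 ?mul0r //; first by rewrite mulr_ge0 ?powR_ge0.
    by rewrite gt_eqF // ltr_wpDl // invr_gt0.
  rewrite addrC powRD ?bn0 ?implybT // powRr1 // -/b aE; lra.
have h2 : b <= (2 / D * E) `^ theta.
  have -> : b = (b `^ (1 + alpha^-1)) `^ theta.
    rewrite -powRrM (_ : (1 + alpha^-1) * theta = 1) ?powRr1 //.
    by rewrite /theta; field; rewrite !gt_eqF //; lra.
  apply: ge0_ler_powR; rewrite ?nnegrE ?powR_ge0 //; first exact: ltW.
  by rewrite mulr_ge0 // divr_ge0 // ltW.
rewrite powRM // ?divr_ge0 // ?(ltW D0) // in h2.
by rewrite aE -mulrA ler_pM2l.
Qed.

End PowerEstimates.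

(** * Normal cones *)

Definition normal_cone (R : realType) k (C : set 'cV[R]_k) (xb : 'cV[R]_k) : set 'cV[R]_k :=
  [set y | forall c, C c -> dotv y (c - xb) <= 0].

Section NormalCone.
Variables (R : realType) (k : nat) (C : set 'cV[R]_k) (xb : 'cV[R]_k).
Local Notation Nc := (normal_cone C xb).

Lemma normal_coneD y z : Nc y -> Nc z -> Nc (y + z).
Proof. by move=> hy hz c Cc; rewrite dotvDl; have := hy c Cc; have := hz c Cc; lra. Qed.

Lemma normal_cone0 : Nc 0.
Proof. by move=> c _; rewrite dotv0l. Qed.

Lemma normal_coneZ t y : 0 <= t -> Nc y -> Nc (t *: y).
Proof. by move=> t0 hy c Cc; rewrite dotvZl mulr_ge0_le0 // hy. Qed.

Lemma normal_cone_mulmx p (Y : 'M[R]_(k, p)) (b : 'cV[R]_p) :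
  (forall j, Nc (col j Y)) -> (forall j, 0 <= b j 0) -> Nc (Y *m b).
Proof.
move=> NY b0; rewrite mulmx_sum_col.
elim: (index_enum _) => [|j r IH]; first by rewrite big_nil; exact: normal_cone0.
by rewrite big_cons; apply: normal_coneD => //; apply: normal_coneZ.
Qed.

End NormalCone.

(** * Constraint qualification, regularity and error bound for a single stacked set *)

Section Duality.
Variables (R : realType) (N n : nat) (A : 'M[R]_(N, n)) (C : set 'cV[R]_N).
Variables (xs x0 g : 'cV[R]_n) (T : set 'cV[R]_N) (alpha s0 M : R).
Let xb := A *m xs.
Local Notation Nc := (normal_cone C xb).

Definition primal_normal : set 'cV[R]_n :=
  [set h | forall x, C (A *m x) -> dotv h (x - xs) <= 0].
Definition dual_solutions : set 'cV[R]_N := [set y | Nc y /\ A^T *m y = g].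

Hypothesis Ccv : convex_e C.
Hypothesis Cxb : C xb.
Hypothesis ri_x0 : ri C (A *m x0).
Hypothesis Tcl : closed_e T.
Hypothesis Tcv : convex_e T.
Hypothesis Tcone : is_cone T.
Hypothesis CT : forall c, C c -> T (c - xb).
Hypothesis alpha0 : 0 < alpha.
Hypothesis alpha1 : alpha <= 1.
Hypothesis s00 : 0 < s0.
Hypothesis M0 : 0 < M.
Hypothesis Tapprox : forall h, T h -> enorm h <= s0 ->
  exists2 x, C x & enorm (x - xb - h) <= M * enorm h `^ (1 + alpha).
Hypothesis g_retract : forall s, primal_normal s ->
  exists2 mu, 0 < mu & primal_normal (g - mu *: s).

(** The residual of the projection on [T] is polar to [T], hence normal to [C] by [CT]; pairing it
    with [w] forces it to vanish. *)
Lemma bipolar w : (forall y, Nc y -> dotv y w <= 0) -> T w.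
Proof.
move=> hw; have [t [Tt [tt ht]]] := cone_projection w Tcl Tcv Tcone.
have /hw h : Nc (w - t) by move=> c /CT /ht.
have h' : dotv (w - t) (w - t) <= 0 by rewrite dotvBr tt subr0.
have /enorm_eq0/eqP : enorm (w - t) = 0.
  by apply/eqP; rewrite -sqrf_eq0 enorm_sqr eq_le h' dotv_ge0.
by rewrite subr_eq0 => /eqP ->.
Qed.

(** The error s^(1 + alpha) is superlinear in the step, so it drops below e s once s^alpha is
    small. *)
Lemma tangent_first_order h e : T h -> 0 < e ->
  exists s c, [/\ 0 < s, s <= 1, C c & enorm (c - xb - s *: h) <= e * s].
Proof.
move=> Th e0; have h1 : 0 < enorm h + 1 by rewrite ltr_wpDl.
set H := enorm h `^ (1 + alpha); have H0 : 0 <= H by exact: powR_ge0.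
have MH : 0 < M * H + 1 by rewrite ltr_wpDl // mulr_ge0 // ltW.
pose q := (e / (M * H + 1)) `^ alpha^-1.
have q0 : 0 < q by rewrite powR_gt0 // divr_gt0.
pose s := Num.min 1 (Num.min (s0 / (enorm h + 1)) q).
have sp : 0 < s by rewrite !lt_min ltr01 q0 divr_gt0.
have sp' := ltW sp.
have s1 : s <= 1 by rewrite ge_min lexx.
have ss0 : s * (enorm h + 1) <= s0 by rewrite -ler_pdivlMr // !ge_min lexx orbT.
have sq : s <= q by rewrite !ge_min lexx !orbT.
have sa : s `^ alpha <= e / (M * H + 1).
  have -> : e / (M * H + 1) = q `^ alpha.
    rewrite /q -powRrM mulVf ?gt_eqF // powRr1 //.
    by rewrite divr_ge0 // ltW.
  by apply: ge0_ler_powR; rewrite ?nnegrE // ltW.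
have Tsh : T (s *: h) by apply: (proj2 Tcone).
have nsh : enorm (s *: h) = s * enorm h by rewrite enormZ ger0_norm.
have [|c Cc hc] := Tapprox Tsh; first by rewrite nsh; lra.
exists s, c; split => //; rewrite (le_trans hc) // nsh powRM // -/H.
rewrite powRD; last by rewrite (gt_eqF sp) implybT.
rewrite powRr1 //.
have h2 : (M * H) * s `^ alpha <= e.
  have h3 : (M * H + 1) * s `^ alpha <= e by rewrite mulrC -ler_pdivlMr.
  have := powR_ge0 s alpha; lra.
have -> : M * (s * s `^ alpha * H) = (M * H * s `^ alpha) * s by ring.
by rewrite ler_wpM2r.
Qed.

(* Normal cone chain rule up to closure: a functional normal to the feasible set
   that is separated from [A^T Nc] by [h] would have [A h] tangent to [C], and the
   Slater point [x0] turns [h] into an actual feasible direction. *)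
Lemma primal_normal_approx h e : primal_normal h -> 0 < e ->
  exists2 y, Nc y & enorm (h - A^T *m y) < e.
Proof.
move=> Nh.
(* The closure of the image of [Nc] under A^T, so that one can project on it. *)
pose D := [set x : 'cV[R]_n | forall e, 0 < e -> exists2 y, Nc y & enorm (x - A^T *m y) < e].
suff Dh : D h by exact: Dh.
have Dcl : closed_e D.
  move=> x hx d d0; have d2 : 0 < d / 2 by lra.
  have [x' [Dx' xx']] := hx _ d2; have [y Ny hy] := Dx' _ d2.
  by exists y => //; have := enorm_triangle x x' (A^T *m y); lra.
have Dcone : is_cone D.
  split=> [d d0|x t Dx t0 d d0].
    by exists 0; [exact: normal_cone0|rewrite mulmx0 subr0 enorm0].
  have t1 : 0 < t + 1 by lra.
  have [y Ny hy] := Dx _ (divr_gt0 d0 t1).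
  exists (t *: y); first exact: normal_coneZ.
  rewrite -scalemxAr -scalerBr enormZ ger0_norm //.
  move: hy; rewrite ltr_pdivlMr // => hy.
  by have := enorm_ge0 (x - A^T *m y); lra.
have Dadd x x' : D x -> D x' -> D (x + x').
  move=> Dx Dx' d d0; have d2 : 0 < d / 2 by lra.
  have [[y Ny hy] [y' Ny' hy']] := (Dx _ d2, Dx' _ d2).
  exists (y + y'); first exact: normal_coneD.
  rewrite mulmxDr opprD addrACA.
  by have := enormD (x - A^T *m y) (x' - A^T *m y'); lra.
have Dcv : convex_e D.
  move=> x y t Dx Dy t0 t1.
  by apply: Dadd; apply: (proj2 Dcone) => //; rewrite subr_ge0.
have [t [Dt [tt ht]]] := cone_projection h Dcl Dcv Dcone.
have [/eqP|w0] := eqVneq (h - t) 0; first by rewrite subr_eq0 => /eqP ->.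
set w := h - t in w0 tt ht; exfalso.
have a0 : 0 < dotv h w.
  have -> : dotv h w = dotv w w.
    by rewrite -[in LHS](subrK t h) -/w dotvDl (dotvC t) tt addr0.
  by rewrite -enorm_sqr exprn_gt0 // enorm_gt0.
have TAw : T (A *m w).
  apply: bipolar => y Ny; rewrite dotvC dotv_mulmx; apply: ht => d d0.
  by exists y; rewrite ?subrr ?enorm0.
have [p [U [SU hU]]] := spanning_subfamily [set c - xb | c in C].
have SUC j : C (col j U + xb) by case: (SU j) => c Cc <-; rewrite subrK.
have [r r0 hr] := ri_margin ri_x0 Cxb SUC.
(* Elements of [T] are limits of multiples of c - xb and ranges are closed; residuals thus lie in
   directions covered by the margin at A x0. *)
have TU z : T z -> exists b, z = U *m b.
  move=> Tz; apply: (@range_closed R _ _ U) => d d0.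
  have [s [c [sp _ Cc hc]]] := tangent_first_order Tz (divr_gt0 d0 (ltr0n _ 2)).
  have [|b bE] := hU (c - xb); first by exists c.
  exists (s^-1 *: (c - xb)); split; first by exists (s^-1 *: b); rewrite -scalemxAr -bE.
  have -> : z - s^-1 *: (c - xb) = - (s^-1 *: (c - xb - s *: z)).
    rewrite (scalerBr s^-1 (c - xb)) scalerA mulVf ?gt_eqF // scale1r.
    by rewrite opprB.
  rewrite enormN enormZ gtr0_norm ?invr_gt0 // mulrC ltr_pdivrMr //.
  rewrite (le_lt_trans hc) // ltr_pM2r //; lra.
have [MU [MU0 hMU]] := bounded_preimage U.
clearbody w.
set a := dotv h w in a0; set b := dotv h (x0 - xs).
(* The share of the Slater direction x0 - xs, so small that it costs at most a / 4 in the pairing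
   with [h]. *)
pose eta := Num.min (1 / 2) (a / (4 * (`|b| + 1))).
have b1 : 0 < `|b| + 1 by rewrite ltr_wpDl.
have eta0 : 0 < eta by rewrite lt_min !divr_gt0 // mulr_gt0.
have eta2 : eta <= 1 / 2 by rewrite ge_min lexx.
have etab : eta * (`|b| + 1) <= a / 4.
  rewrite -ler_pdivlMr //.
  have -> : a / 4 / (`|b| + 1) = a / (4 * (`|b| + 1)) by field; rewrite gt_eqF.
  by rewrite ge_min lexx orbT.
(* With this tolerance the residual c - xb - s A w has coefficients of norm at most r * lam, where
   lam = s * eta; scaled by (1 - lam) / lam they fit in the margin [r]. *)
have e'0 : 0 < r * eta / MU by rewrite divr_gt0 // mulr_gt0.
have [s [c [sp s1 Cc hc]]] := tangent_first_order TAw e'0.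
pose lam := s * eta.
have lam0 : 0 < lam by rewrite mulr_gt0.
have lam1 : lam <= 1 / 2.
  by rewrite (le_trans _ eta2) // ler_piMl // ltW.
have [b1' b1E] : exists b', c - xb - s *: (A *m w) = U *m b'.
  have [|u uE] := hU (c - xb); first by exists c.
  have [u' u'E] := TU _ TAw.
  by exists (u - s *: u'); rewrite mulmxBr -scalemxAr -uE -u'E.
have [b2 [b2E b2n]] := hMU b1'.
have {}b2n : enorm b2 <= r * lam.
  rewrite (le_trans b2n) // -b1E (le_trans (ler_wpM2l (ltW MU0) hc)) //.
  by rewrite /lam; have -> : MU * (r * eta / MU * s) = r * (s * eta)
    by field; rewrite gt_eqF.
have Cz : C (A *m x0 + U *m (- ((1 - lam) / lam) *: b2)).
  apply: hr; rewrite enormZ normrN ger0_norm; last by rewrite divr_ge0 // ?ltW //; lra.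
  rewrite mulrAC ler_pdivrMr // (le_trans _ b2n) // ler_piMl //; lra.
(* The weights lam and 1 - lam cancel the residual, so the convex combination lands in the range of
   [A] and yields a feasible point. *)
have := Ccv Cz Cc (ltW lam0) (_ : lam <= 1).
have -> : lam *: (A *m x0 + U *m (- ((1 - lam) / lam) *: b2)) + (1 - lam) *: c
    = A *m (xs + (1 - lam) * s *: w + lam *: (x0 - xs)).
  rewrite -scalemxAr b2E -b1E !mulmxDr -!scalemxAr mulmxBr -/xb.
  move: (A *m x0) (A *m w) => u1 u2.
  by apply/matrixP => i j; rewrite !mxE; field; rewrite gt_eqF.
move=> H; have {H} /Nh : C (A *m (xs + (1 - lam) * s *: w + lam *: (x0 - xs))).
  by apply: H; lra.
have -> : xs + (1 - lam) * s *: w + lam *: (x0 - xs) - xs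
    = s *: ((1 - lam) *: w + eta *: (x0 - xs)).
  by rewrite /lam; apply/matrixP => i j; rewrite !mxE; ring.
rewrite dotvZr pmulr_rle0 // dotvDr !dotvZr -/a -/b.
have : eta * `|b| <= a / 4 by lra.
have : - (eta * b) <= eta * `|b| by rewrite -mulrN ler_wpM2l ?(ltW eta0) // ler_normr lexx orbT.
have : lam * a <= a / 2 by have := ler_wpM2r (ltW a0) lam1; lra.
lra.
Qed.

(** Reserve mu times the sum y1 of the columns of [Y]: g - mu A^T y1 is still a primal normal, hence
    nearly A^T y with y in [Nc]. The error lies in the range of A^T Y and is paid for by perturbing
    the reserved coefficients, which turns the approximation into an exact solution. *)
Lemma relative_interior_dual_solution p (Y : 'M[R]_(N, p)) :
  (forall j, Nc (col j Y)) -> (forall y, Nc y -> exists b, y = Y *m b) ->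
  exists yh r, [/\ dual_solutions yh, 0 < r &
    forall c, enorm c <= r -> Nc (yh + Y *m c)].
Proof.
move=> NY hY; pose y1 : 'cV[R]_N := Y *m const_mx 1.
have Ny1 : Nc y1 by apply: normal_cone_mulmx => // j; rewrite mxE.
have Nprim y : Nc y -> primal_normal (A^T *m y).
  by move=> Ny x Cx; rewrite dotvC -dotv_mulmx mulmxBr dotvC; exact: Ny.
have [mu mu0 hmu] := g_retract (Nprim _ Ny1).
have primY h : primal_normal h -> exists b, h = (A^T *m Y) *m b.
  move=> Nh; apply: (@range_closed R _ _ (A^T *m Y)) => e e0.
  have [y Ny hy] := primal_normal_approx Nh e0.
  exists (A^T *m y); split => //.
  by have [b ->] := hY y Ny; exists b; rewrite mulmxA.
have [K [K0 hK]] := bounded_preimage (A^T *m Y).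
have e0 : 0 < mu / 2 / K by rewrite !divr_gt0.
have [y Ny hy] := primal_normal_approx hmu e0.
have [b bE] : exists b, g - mu *: (A^T *m y1) - A^T *m y = (A^T *m Y) *m b.
  have [u ->] := primY _ hmu; have [u' ->] := primY _ (Nprim _ Ny).
  by exists (u - u'); rewrite mulmxBr.
have [c' [c'E c'n]] := hK b.
have {}c'n : enorm c' <= mu / 2.
  rewrite (le_trans c'n) // -bE mulrC -ler_pdivlMr //; exact: ltW.
(* Half of mu covers the correction c', the other half is the radius: all coefficients mu + c' + c
   stay nonnegative. *)
exists (y + mu *: y1 + Y *m c'), (mu / 2).
have N' c : enorm c <= mu / 2 -> Nc (y + mu *: y1 + Y *m c' + Y *m c).
  move=> cn.
  have -> : y + mu *: y1 + Y *m c' + Y *m c = y + Y *m (const_mx mu + c' + c).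
    have -> : const_mx mu = mu *: const_mx 1 :> 'cV[R]_p.
      by apply/matrixP => i j; rewrite !mxE mulr1.
    by rewrite !mulmxDr -scalemxAr -/y1 !addrA.
  apply: normal_coneD => //; apply: normal_cone_mulmx => // j; rewrite !mxE.
  have := coord_le_enorm c j; have := coord_le_enorm c' j.
  by rewrite !ler_norml => /andP[u1 u2] /andP[u3 u4]; lra.
split => //; last by rewrite divr_gt0.
split; first by have := N' 0; rewrite mulmx0 addr0 enorm0; apply; rewrite ltW // divr_gt0.
rewrite !mulmxDr mulmxA c'E -bE -scalemxAr.
by move: (A^T *m y) (A^T *m y1) => u w; apply/matrixP => i j; rewrite !mxE; ring.
Qed.

(** Normality tested at the points A x0 + t u_j with |t| <= r bounds the pairing of a dual solution
    with each column u_j. So U^T and A^T are bounded on dual solutions, and only their common kernel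
    is left uncontrolled. *)
Lemma dual_solutions_bounded_mod_lineality p (U : 'M[R]_(N, p)) :
  (forall j, C (col j U + xb)) -> dual_solutions !=set0 ->
  exists B, forall y, dual_solutions y ->
    exists z, [/\ U^T *m z = 0, A^T *m z = 0 & enorm (y - z) <= B].
Proof.
move=> SU [yh [Nyh gyh]].
have [r r0 hr] := ri_margin ri_x0 Cxb SU.
(* Every dual solution y has the same slack at A x0: <y, A x0 - xb> = <g, x0 - xs>. *)
pose be := - dotv g (x0 - xs).
have bnd y j : dual_solutions y -> `|(U^T *m y) j 0| <= be / r.
  move=> [Ny gy]; have -> : (U^T *m y) j 0 = dotv y (col j U).
    by rewrite mxE; apply: eq_bigr => i _; rewrite !mxE mulrC.
  have E : dotv y (A *m x0 - xb) = - be.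
    by rewrite /be opprK -mulmxBr dotvC dotv_mulmx gy dotvC.
  have ecol t : U *m (t *: col j 1%:M) = t *: col j U.
    by rewrite -scalemxAr !colE mul1mx.
  have key t : `|t| <= r -> t * dotv y (col j U) <= be.
    move=> tr; have /hr : enorm (t *: col j (1%:M : 'M[R]_p)) <= r.
      by rewrite enormZ enorm_col1 mulr1.
    rewrite ecol => /Ny; rewrite addrAC dotvDr E dotvZr; lra.
  have r0' := ltW r0.
  rewrite ler_norml ler_pdivlMr // -mulNr ler_pdivrMr //.
  have := key r; have := key (- r); rewrite normrN ger0_norm // lexx => /(_ isT) k1 /(_ isT) k2.
  by apply/andP; split; lra.
pose Psi := col_mx U^T A^T.
have [K [K0 hK]] := bounded_preimage Psi.
have Sh : dual_solutions yh by [].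
pose b2 := 2 * (be / r).
exists (enorm yh + K * ((p + n)%:R * `|b2|)) => y Sy.
have Pn : enorm (Psi *m (y - yh)) <= (p + n)%:R * `|b2|.
  apply: enorm_le_coord => i; rewrite /Psi mul_col_mx.
  case: (split_ordP i) => j ->; rewrite ?col_mxEu ?col_mxEd.
    have -> : (U^T *m (y - yh)) j 0 = (U^T *m y) j 0 - (U^T *m yh) j 0.
      by rewrite mulmxBr; move: (U^T *m y) (U^T *m yh) => u w; rewrite !mxE.
    rewrite (le_trans (ler_normB _ _)) // (le_trans _ (ler_norm _)) //.
    by have := bnd y j Sy; have := bnd yh j Sh; rewrite /b2; lra.
  by rewrite mulmxBr gyh (proj2 Sy) subrr mxE normr0.
have [v [vE vn]] := hK (y - yh).
exists (y - yh - v).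
have /eqP : Psi *m (y - yh - v) = 0 by rewrite (mulmxBr Psi (y - yh)) vE subrr.
rewrite /Psi mul_col_mx -(col_mx0 R p n 1) => /eqP /eq_col_mx[-> ->]; split => //.
have -> : y - (y - yh - v) = yh + v by apply/matrixP => i j; rewrite !mxE; ring.
rewrite (le_trans (enormD _ _)) // lerD2l (le_trans vn) // ler_wpM2l // ltW //.
Qed.

(* Moving from [xb] along the projection [h] of [y] on the tangent cone for a
   distance [tau] gains [tau |h|] up to a curvature loss of order [tau^(1+alpha)];
   the bound comes from the optimal [tau], proportional to [|h|^(1/alpha)]. *)
Lemma support_growth B : exists2 D, 0 < D & forall y E, enorm y <= B ->
  (forall c, C c -> dotv y (c - xb) <= E) ->
  exists q, [/\ Nc q, enorm (y - q) <= enorm y &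
    enorm (y - q) <= D * E `^ (alpha / (1 + alpha))].
Proof.
have s0a : 0 < s0 `^ alpha by rewrite powR_gt0.
(* The first term keeps the curvature loss below half of the gain tau * a, the second ensures tau <=
   s0, the third D > 0. *)
pose D := 2 * `|B| * M + `|B| / s0 `^ alpha + 1.
have BM : 0 <= `|B| * M by rewrite mulr_ge0 // ltW.
have Bs : 0 <= `|B| / s0 `^ alpha by rewrite divr_ge0 // ltW.
have D0 : 0 < D by rewrite /D; lra.
have an0 : alpha != 0 by rewrite gt_eqF.
exists (D * (2 / D) `^ (alpha / (1 + alpha))).
  by rewrite mulr_gt0 // powR_gt0 // divr_gt0.
move=> y E yB hE.
have [h [Th [hh hT]]] := cone_projection y Tcl Tcv Tcone.
exists (y - h).
have -> : y - (y - h) = h by rewrite opprB addrC subrK.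
have yh : dotv y h = enorm h ^+ 2.
  by rewrite enorm_sqr -[in LHS](subrK h y) dotvDl hh add0r.
have hy : enorm h <= enorm y.
  have [->|hn] := eqVneq (enorm h) 0; first exact: enorm_ge0.
  have hp : 0 < enorm h by rewrite lt0r hn enorm_ge0.
  by rewrite -(ler_pM2r hp) -expr2 -yh; exact: dotv_le_enorm.
split => //; first by move=> c /CT /hT.
apply: powR_growth_inverse => //.
set a := enorm h; have a0 : 0 <= a by exact: enorm_ge0.
pose tau := (a / D) `^ alpha^-1.
have tau0 : 0 <= tau by exact: powR_ge0.
have aB : a <= `|B| by rewrite (le_trans hy) // (le_trans yB) // ler_norm.
have aD0 : 0 <= a / D by rewrite divr_ge0 // ltW.
have taua : tau `^ alpha = a / D by rewrite /tau -powRrM mulVf // powRr1.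
have tau_s0 : tau <= s0.
  have -> : s0 = (s0 `^ alpha) `^ alpha^-1 by rewrite -powRrM divff // powRr1 // ltW.
  apply: ge0_ler_powR; rewrite ?nnegrE ?invr_ge0 ?(ltW alpha0) ?(ltW s0a) //.
  rewrite ltW // ltr_pdivrMr // mulrC -ltr_pdivrMr //.
  apply: (le_lt_trans (y := `|B| / s0 `^ alpha)).
    by rewrite ler_pM2r ?invr_gt0.
  rewrite /D; lra.
rewrite -/tau; have [an|an] := eqVneq a 0.
  have E0 : 0 <= E by have := hE xb Cxb; rewrite subrr dotv0r.
  by rewrite an mulr0 mulr_ge0.
have ap : 0 < a by rewrite lt0r an.
have Ttau : T ((tau / a) *: h) by apply: (proj2 Tcone) => //; rewrite divr_ge0.
have ntau : enorm ((tau / a) *: h) = tau.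
  by rewrite enormZ ger0_norm ?divr_ge0 // -/a mulfVK.
have [|x Cx hx] := Tapprox Ttau; first by rewrite ntau.
move: hx; rewrite ntau => hx; set w := x - xb - (tau / a) *: h in hx.
have E1 : dotv y (x - xb) = tau * a + dotv y w.
  have -> : x - xb = (tau / a) *: h + w by rewrite [RHS]addrC subrK.
  by rewrite dotvDr dotvZr yh -/a; congr (_ + _); field.
have tE : tau `^ (1 + alpha) = tau * (a / D).
  have [t0|tn] := eqVneq tau 0; first by rewrite t0 mul0r powR0 // gt_eqF // addr_gt0.
  by rewrite powRD ?tn ?implybT // powRr1 // taua.
have w1 : `|dotv y w| <= `|B| * (M * (tau * (a / D))).
  rewrite (le_trans (cauchy_schwarz _ _)) // -tE; apply: ler_pM => //.
  exact: le_trans yB (ler_norm _).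
have w2 : `|B| * (M * (tau * (a / D))) <= tau * a / 2.
  have -> : `|B| * (M * (tau * (a / D))) = (tau * a) * ((`|B| * M) / D) by ring.
  apply: ler_wpM2l; first exact: mulr_ge0.
  by rewrite ler_pdivrMr // /D; lra.
have := hE x Cx; rewrite E1.
have : - dotv y w <= `|dotv y w| by rewrite ler_normr lexx orbT.
lra.
Qed.

(* Linear regularity of the affine space [A^T y = g] and the cone [Nc], which meet
   in a relative interior point: a point of [Nc] is corrected by averaging it with
   a point of [Nc] that compensates its residual. *)
Lemma dual_solutions_regularity p (Y : 'M[R]_(N, p)) yh r :
  (forall y, Nc y -> exists b, y = Y *m b) ->
  dual_solutions yh -> 0 < r -> (forall c, enorm c <= r -> Nc (yh + Y *m c)) ->
  forall B, exists2 K, 0 < K & forall q, Nc q -> enorm q <= B ->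
    exists2 s, dual_solutions s & enorm (q - s) <= K * enorm (A^T *m q - g).
Proof.
move=> hY [Nyh gyh] r0 hr B.
have [K [K0 hK]] := bounded_preimage (A^T *m Y).
have [MY [MY0 hMY]] := mulmx_bounded Y.
pose L := (`|B| + enorm yh) / r + MY.
have L0 : 0 < L by rewrite /L ltr_wpDl // divr_ge0 ?addr_ge0 // ltW.
exists (L * K); first exact: mulr_gt0.
move=> q Nq qB.
have [b0 q0E] := hY q Nq.
have [b1 yhE] := hY yh Nyh.
have [c [cE cn]] := hK (b1 - b0).
have cE' : A^T *m (Y *m c) = g - A^T *m q.
  by rewrite mulmxA cE mulmxBr -!mulmxA -yhE -q0E gyh.
have {}cn : enorm c <= K * enorm (A^T *m q - g).
  by rewrite enorm_distC -cE' mulmxA cE.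
have m0 : 0 <= enorm c by exact: enorm_ge0.
set m := enorm c in m0 cn.
have mr : 0 < r + m by lra.
have mr0 : r + m != 0 by rewrite gt_eqF.
have Nm : Nc (m *: yh + r *: (Y *m c)).
  have [mz|mn] := eqVneq m 0.
    have -> : c = 0 by exact: enorm_eq0.
    by rewrite mz scale0r add0r mulmx0 scaler0; exact: normal_cone0.
  have -> : m *: yh + r *: (Y *m c) = m *: (yh + Y *m ((r / m) *: c)).
    rewrite -scalemxAr; move: (Y *m c) => u.
    by apply/matrixP => i j; rewrite !mxE; field.
  apply: normal_coneZ => //; apply: hr.
  by rewrite enormZ ger0_norm ?divr_ge0 ?(ltW r0) // -/m mulfVK.
(* As A^T Y c = g - A^T q, the weights r and m make the image under A^T exactly (r + m) g before
   normalization. *)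
exists ((r + m)^-1 *: (r *: q + (m *: yh + r *: (Y *m c)))).
  split.
    apply: normal_coneZ; first by rewrite invr_ge0 ltW.
    by apply: normal_coneD => //; apply: normal_coneZ => //; exact: ltW.
  rewrite -scalemxAr !mulmxDr -!scalemxAr gyh cE'; move: (A^T *m q) => u.
  by apply/matrixP => i j; rewrite !mxE; field.
have -> : q - (r + m)^-1 *: (r *: q + (m *: yh + r *: (Y *m c)))
    = (r + m)^-1 *: (m *: (q - yh) - r *: (Y *m c)).
  move: (Y *m c) => u; by apply/matrixP => i j; rewrite !mxE; field.
rewrite enormZ gtr0_norm ?invr_gt0 // mulrC ler_pdivrMr //.
have h1 : enorm (m *: (q - yh) - r *: (Y *m c)) <= m * (`|B| + enorm yh) + r * (MY * m).
  rewrite (le_trans (enormB _ _)) // !enormZ (ger0_norm m0) (gtr0_norm r0).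
  apply: lerD; last by rewrite ler_wpM2l // ltW.
  by rewrite ler_wpM2l // (le_trans (enormB _ _)) // lerD2r (le_trans qB) // ler_norm.
rewrite (le_trans h1) //.
have h2 : m * (`|B| + enorm yh) + r * (MY * m) = (L * m) * r.
  by rewrite /L; field; rewrite gt_eqF.
rewrite h2 (le_trans (y := L * m * (r + m))) //.
  have : 0 <= L * m * m by rewrite !mulr_ge0 // ltW.
  lra.
by rewrite ler_wpM2r ?(ltW mr) // -mulrA ler_wpM2l // ltW.
Qed.

(** Subtracting a [z] that affects neither A^T y nor the pairings with C - xb makes [y] bounded;
    adding it back preserves dual solutions. The gap bound [E] is stated through test points c,
    which keeps the argument free of suprema. *)
Lemma dual_error_bound :
  dual_solutions !=set0 /\
  exists2 K, 0 < K & forall y E,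
    (exists2 s, dual_solutions s & enorm (y - s) <= 1) ->
    (forall c, C c -> (1/2) * enorm (A^T *m y - g) ^+ 2 + dotv y (c - xb) <= E) ->
    exists2 s, dual_solutions s & enorm (y - s) <= K * E `^ (alpha / (1 + alpha)).
Proof.
have [p [Y [NY hY]]] := spanning_subfamily Nc.
have [yh [r [Syh r0 hr]]] := relative_interior_dual_solution NY hY.
split; first by exists yh.
have [p' [U [SU hU]]] := spanning_subfamily [set c - xb | c in C].
have SUC j : C (col j U + xb) by case: (SU j) => c Cc <-; rewrite subrK.
have [|B0 hB0] := dual_solutions_bounded_mod_lineality SUC; first by exists yh.
pose B := `|B0| + 1.
have B1 : 1 <= B by rewrite /B lerDr.
have [D D0 hD] := support_growth B.
(* The point q of [Nc] satisfies |y' - q| <= |y'| <= B, hence |q| <= 2 B. *)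
have [K K0 hK] := dual_solutions_regularity hY Syh r0 hr (2 * B).
have [MA [MA0 hMA]] := mulmx_bounded A^T.
set theta := alpha / (1 + alpha) in hD *.
have a1 : 0 < 1 + alpha by rewrite addr_gt0.
have th0 : 0 < theta by exact: divr_gt0.
(* Here alpha <= 1 enters: the quadratic residual is dominated by the power [theta]. *)
have th1 : theta <= 1 / 2 by rewrite ler_pdivrMr //; have := alpha1; lra.
pose W := MA * B + enorm g.
have W0 : 0 < W by rewrite ltr_wpDr // mulr_gt0 //; lra.
pose P := W * (2 / W ^+ 2) `^ theta.
have P0 : 0 <= P by rewrite mulr_ge0 ?powR_ge0 // ltW.
have [Dp [Kp MAp]] : 0 <= D /\ 0 <= K /\ 0 <= MA by split; [|split]; exact: ltW.
exists (D + K * (MA * D + P)).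
  by rewrite ltr_pwDl // mulr_ge0 // addr_ge0 // mulr_ge0.
move=> y E [s Ss ys] hE.
have [z [Uz Az sz]] := hB0 s Ss.
have zC c : C c -> dotv z (c - xb) = 0.
  move=> Cc; have [|b ->] := hU (c - xb); first by exists c.
  by rewrite dotvC dotv_mulmx Uz dotv0r.
pose y' := y - z.
have y'B : enorm y' <= B.
  have -> : y' = (y - s) + (s - z) by rewrite /y' addrA subrK.
  by have := enormD (y - s) (s - z); have := ler_norm B0; rewrite /B; lra.
have Ay' : A^T *m y' = A^T *m y by rewrite mulmxBr Az subr0.
have y'E c : C c -> dotv y' (c - xb) = dotv y (c - xb).
  by move=> Cc; rewrite dotvBl zC // subr0.
have sq0 : 0 <= (1/2) * enorm (A^T *m y - g) ^+ 2 by rewrite mulr_ge0 // sqr_ge0.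
have [|q [Nq qy qE]] := hD y' E y'B.
  by move=> c Cc; rewrite y'E //; have := hE c Cc; lra.
have w1 : enorm (A^T *m y' - g) <= P * E `^ theta.
  apply: half_square_le_powR => //.
    rewrite (le_trans (enormB _ _)) // lerD2r (le_trans (hMA _)) // ler_wpM2l //.
  by have := hE xb Cxb; rewrite subrr dotv0r addr0 Ay'.
have [|s' [Ns' gs'] s'E] := hK q Nq.
  by have := enorm_triangle q y' 0; rewrite !subr0 (enorm_distC q); lra.
exists (s' + z).
  split; last by rewrite mulmxDr Az addr0.
  by move=> c Cc; rewrite dotvDl zC // addr0; exact: Ns'.
have -> : y - (s' + z) = y' - s' by rewrite /y'; apply/matrixP => i j; rewrite !mxE; ring.
have t1 := enorm_triangle y' q s'.
have t2 : enorm (A^T *m q - g) <= (MA * D + P) * E `^ theta.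
  have -> : A^T *m q - g = (A^T *m y' - g) - A^T *m (y' - q).
    by rewrite (mulmxBr A^T y'); move: (A^T *m y') (A^T *m q) => a b;
      apply/matrixP => i j; rewrite !mxE; ring.
  rewrite (le_trans (enormB _ _)) // mulrDl addrC lerD //.
  by rewrite (le_trans (hMA _)) // -mulrA ler_wpM2l.
have t3 : K * enorm (A^T *m q - g) <= K * ((MA * D + P) * E `^ theta) by rewrite ler_wpM2l.
rewrite mulrDl -mulrA; lra.
Qed.

End Duality.

(** * Product spaces and the dual function *)

Section Stacking.
Variables (R : realType) (l : nat) (m : 'I_l -> nat).
Local Notation N := (\sum_(i < l) m i)%N.

Definition stack (y : prodv R m) : 'cV[R]_N := \mxcol_i y i.
Definition blocks (z : 'cV[R]_N) : prodv R m := fun i => submxcol z i.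
Definition prodset (C : forall i, set 'cV[R]_(m i)) : set 'cV[R]_N :=
  [set z | forall i, C i (blocks z i)].

Lemma blocksK z : stack (blocks z) = z.
Proof. exact: submxcolK. Qed.

Lemma stackK y i : blocks (stack y) i = y i.
Proof. exact: mxcolK. Qed.

Lemma blocksD z w i : blocks (z + w) i = blocks z i + blocks w i.
Proof. exact: submxcolD. Qed.

Lemma blocksB z w i : blocks (z - w) i = blocks z i - blocks w i.
Proof. exact: submxcolB. Qed.

Lemma blocksZ t z i : blocks (t *: z) i = t *: blocks z i.
Proof. by apply/matrixP => a b; rewrite !mxE. Qed.

Lemma stack_sub y z : stack (psub y z) = stack y - stack z.
Proof. exact: mxcolB. Qed.

Lemma dotv_stack y z : dotv (stack y) (stack z) = pdot y z.
Proof.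
have dotE k (u w : 'cV[R]_k) : dotv u w = (u^T *m w) 0 0.
  by rewrite mxE; apply: eq_bigr => a _; rewrite mxE.
rewrite dotE /stack tr_mxcol mul_mxrow_mxcol summxE.
by apply: eq_bigr => i _; rewrite dotE.
Qed.

Lemma dotv_blocks z w : dotv z w = \sum_i dotv (blocks z i) (blocks w i).
Proof. by rewrite -{1}(blocksK z) -{1}(blocksK w) dotv_stack. Qed.

Lemma pnorm_psub y z : pnorm (psub y z) = enorm (stack y - stack z).
Proof. by rewrite -stack_sub /pnorm -dotv_stack. Qed.

Lemma enorm_block_le z i : enorm (blocks z i) <= enorm z.
Proof.
rewrite -ler_sqr ?nnegrE ?enorm_ge0 // !enorm_sqr dotv_blocks (bigD1 i) //= lerDl.
by apply: sumr_ge0 => j _; exact: dotv_ge0.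
Qed.

Lemma enorm_le_sum_blocks z : enorm z <= \sum_i enorm (blocks z i).
Proof.
have s0 : 0 <= \sum_i enorm (blocks z i) by apply: sumr_ge0 => i _; exact: enorm_ge0.
rewrite -ler_sqr ?nnegrE ?enorm_ge0 // enorm_sqr dotv_blocks expr2 big_distrl /=.
apply: ler_sum => i _; rewrite -enorm_sqr expr2 ler_wpM2l ?enorm_ge0 //.
by rewrite (bigD1 i) //= lerDl sumr_ge0 // => j _; exact: enorm_ge0.
Qed.

Lemma convex_prodset C : (forall i, convex_e (C i)) -> convex_e (prodset C).
Proof.
by move=> Ccv x y t Cx Cy t0 t1 i; rewrite blocksD !blocksZ; exact: Ccv.
Qed.

Lemma closed_prodset C : (forall i, closed_e (C i)) -> closed_e (prodset C).
Proof.
move=> Ccl x hx i; apply: Ccl => e e0; have [y [Cy xy]] := hx e e0.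
exists (blocks y i); split; first exact: Cy.
by rewrite -blocksB (le_lt_trans (enorm_block_le _ _)).
Qed.

Lemma cone_prodset C : (forall i, is_cone (C i)) -> is_cone (prodset C).
Proof.
move=> Cc; split=> [i|x t Cx t0 i]; last by rewrite blocksZ; apply: (proj2 (Cc i)).
by have -> : blocks 0 i = 0; [exact: submxcol0|case: (Cc i)].
Qed.

Lemma affhull_blocks C z i : affhull (prodset C) z -> affhull (C i) (blocks z i).
Proof.
move=> [p [pts [w [hp [hw ->]]]]].
exists p, (fun j => blocks (pts j) i), w; split; first by move=> j; exact: hp.
split => //; rewrite /blocks submxcol_sum; apply: eq_bigr => j _; exact: blocksZ.
Qed.

(** The inverse of 1 plus the sum of the inverses replaces a minimum and covers the empty family. *)
Lemma uniform_positive_bound (r : 'I_l -> R) :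
  (forall i, 0 < r i) -> exists2 e, 0 < e & forall i, e <= r i.
Proof.
move=> r0; pose s := 1 + \sum_i (r i)^-1.
have ri0 i : 0 <= (r i)^-1 by rewrite invr_ge0 ltW.
have s0 : 0 < s by rewrite ltr_wpDr // sumr_ge0.
exists s^-1; first by rewrite invr_gt0.
move=> i; rewrite -[r i]invrK lef_pV2 ?posrE ?invr_gt0 //.
by rewrite /s (bigD1 i) //= addrCA lerDl addr_ge0 // sumr_ge0.
Qed.

Lemma ri_prodset C z : (forall i, ri (C i) (blocks z i)) -> ri (prodset C) z.
Proof.
move=> hz; split; first by move=> i; case: (hz i).
have /choice[r hr] : forall i, exists e, 0 < e /\
    forall w, affhull (C i) w -> enorm (w - blocks z i) < e -> C i w.
  by move=> i; case: (hz i).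
have [|e e0 he] := @uniform_positive_bound r; first by move=> i; case: (hr i).
exists e; split => // w hw wz i; have [_] := hr i; apply; first exact: affhull_blocks.
by rewrite -blocksB (le_lt_trans (enorm_block_le _ _)) // (lt_le_trans wz).
Qed.

End Stacking.

(** * Tangents and normals of products *)

Section ProductTangent.
Variables (R : realType) (l : nat) (m : 'I_l -> nat).
Local Notation N := (\sum_(i < l) m i)%N.

(** The approximations are combined block by block rather than the reductions themselves: radii have
    a common lower bound and constants add up. *)
Lemma product_tangent_approximation (C : forall i, set 'cV[R]_(m i)) (xb : 'cV[R]_N) alpha :
  (forall i, convex_e (C i)) -> prodset C xb -> 0 < alpha ->
  (forall i, C1a_reducible_at alpha (C i) (blocks xb i)) ->
  exists (T : set 'cV[R]_N) s0 M,
    [/\ closed_e T, convex_e T & is_cone T] /\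
    (forall c, prodset C c -> T (c - xb)) /\ 0 < s0 /\ 0 < M /\
    forall h, T h -> enorm h <= s0 ->
      exists2 x, prodset C x & enorm (x - xb - h) <= M * enorm h `^ (1 + alpha).
Proof.
move=> Ccv Cxb a0 hred.
pose P i (q : set 'cV[R]_(m i) * R * R) :=
    [/\ closed_e q.1.1, convex_e q.1.1 & is_cone q.1.1] /\
    (forall c, C i c -> q.1.1 (c - blocks xb i)) /\ 0 < q.1.2 /\ 0 < q.2 /\
    forall h, q.1.1 h -> enorm h <= q.1.2 ->
      exists2 x, C i x & enorm (x - blocks xb i - h) <= q.2 * enorm h `^ (1 + alpha).
have exq i : exists q, P i q.
  have [T [s [M h]]] := reducible_tangent_approximation (Ccv i) (Cxb i) a0 (hred i).
  by exists (T, s, M).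
pose q i := projT1 (cid (exq i)); have hq i : P i (q i) := projT2 (cid (exq i)).
have [|s0 s00 hs0] := @uniform_positive_bound R l (fun i => (q i).1.2).
  by move=> i; case: (hq i) => _ [_ []].
have M0 i : 0 <= (q i).2 by case: (hq i) => _ [_ [_ [/ltW]]].
exists (prodset (fun i => (q i).1.1)), s0, (1 + \sum_i (q i).2).
split; [split|split; [|split; [|split]]] => //.
- by apply: closed_prodset => i; case: (hq i) => [[]].
- by apply: convex_prodset => i; case: (hq i) => [[]].
- by apply: cone_prodset => i; case: (hq i) => [[]].
- by move=> c Cc i; rewrite blocksB; case: (hq i) => _ [h _]; exact: h.
- by rewrite ltr_pwDl // sumr_ge0.
move=> h Th hn.
have exx i : exists x, C i x /\
    enorm (x - blocks xb i - blocks h i) <= (q i).2 * enorm (blocks h i) `^ (1 + alpha).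
  have [_ [_ [_ [_ H]]]] := hq i.
  have [||x Cx hx] := H (blocks h i); [exact: Th| |by exists x].
  by rewrite (le_trans (enorm_block_le _ _)) // (le_trans hn).
pose x : prodv R m := fun i => projT1 (cid (exx i)).
have hx i : C i (x i) /\
    enorm (x i - blocks xb i - blocks h i) <= (q i).2 * enorm (blocks h i) `^ (1 + alpha).
  exact: projT2 (cid (exx i)).
exists (stack x); first by move=> i; rewrite stackK; case: (hx i).
rewrite (le_trans (enorm_le_sum_blocks _)) // mulrDl mul1r ler_wpDl ?powR_ge0 //.
rewrite big_distrl /=; apply: ler_sum => i _.
rewrite !blocksB stackK (le_trans (proj2 (hx i))) // ler_wpM2l //.
apply: ge0_ler_powR; rewrite ?nnegrE ?enorm_ge0 ?enorm_block_le //.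
by rewrite addr_ge0 // ltW.
Qed.

(** Replacing only the i-th block of [xb] by [c] makes all other terms of the pairing vanish. *)
Lemma normal_cone_blocks (C : forall i, set 'cV[R]_(m i)) (xb y : 'cV[R]_N) i :
  prodset C xb -> normal_cone (prodset C) xb y ->
  normal_cone (C i) (blocks xb i) (blocks y i).
Proof.
move=> Cxb Ny c Cc; pose w : prodv R m := @eqtype.dfwith _ (fun j => 'cV[R]_(m j)) (blocks xb) i c.
have /Ny : prodset C (stack w).
  by move=> j; rewrite stackK /w; case: eqtype.dfwithP => [//|j' _]; exact: Cxb.
suff -> : dotv y (stack w - xb) = dotv (blocks y i) (c - blocks xb i) by [].
rewrite dotv_blocks (bigD1 i) //= blocksB stackK {1}/w eqtype.dfwith_in -[RHS]addr0.
congr (_ + _); apply: big1 => j ji.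
by rewrite blocksB stackK /w eqtype.dfwith_out 1?eq_sym // subrr dotv0r.
Qed.

End ProductTangent.

(** * The dual function, its minimizers and the optimal value *)

Section DualFunction.
Variables (R : realType) (l n : nat) (m : 'I_l -> nat).
Variables (A : forall i : 'I_l, 'M[R]_(m i, n)) (v xs : 'cV[R]_n).
Local Notation N := (\sum_(i < l) m i)%N.
Let AA : 'M[R]_(N, n) := \mxcol_i A i.
Let g := v - xs.
Let xb := AA *m xs.

Lemma blocks_mulmx x i : blocks (AA *m x) i = A i *m x.
Proof. by rewrite /AA mxcol_mul /blocks mxcolK. Qed.

Lemma tr_mulmx_stack (y : prodv R m) : AA^T *m stack y = \sum_i (A i)^T *m y i.
Proof. by rewrite /AA tr_mxcol mul_mxrow_mxcol. Qed.

(** As g - v = -xs, this equals -|xs - v|^2 / 2, the negative of the primal optimal value. *)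
Definition dual_value : R :=
  (1/2) * enorm (g - v) ^+ 2 - (1/2) * enorm v ^+ 2 + dotv g xs.

(** Expanding the square around g leaves the cross term -<A^T z - g, xs>, which turns <z, c> into
    <z, c - xb> up to a constant. The gap thus splits into a residual and a support part. *)
Lemma dual_value_expansion (z c : 'cV[R]_N) :
  (1/2) * enorm (AA^T *m z - v) ^+ 2 - (1/2) * enorm v ^+ 2 + dotv z c =
  dual_value + ((1/2) * enorm (AA^T *m z - g) ^+ 2 + dotv z (c - xb)).
Proof.
have -> : dotv z (c - xb) = dotv z c - dotv (AA^T *m z) xs.
  by rewrite dotvBr; congr (_ - _); rewrite dotvC [LHS]dotv_mulmx dotvC.
rewrite /dual_value; move: (AA^T *m z) => p.
have -> : v = g + xs by rewrite subrK.
clearbody g.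
rewrite !enorm_sqr !dotvE (dotvC xs g) (dotvC g p) (dotvC xs p).
by field.
Qed.

Lemma dfun_ge (C : forall i, set 'cV[R]_(m i)) (y : prodv R m) (c : 'cV[R]_N) :
  prodset C c ->
  ((dual_value + ((1/2) * enorm (AA^T *m stack y - g) ^+ 2 + dotv (stack y) (c - xb)))%:E
    <= dfun A C v y)%E.
Proof.
move=> Cc; rewrite -dual_value_expansion EFinD /dfun tr_mulmx_stack.
apply: leeD => //; rewrite dotv_blocks -sumEFin; apply: lee_sum => i _.
by rewrite stackK; apply: ereal_sup_ubound; exists (blocks c i).
Qed.

Lemma dfun_dual_solution (C : forall i, set 'cV[R]_(m i)) (y : prodv R m) :
  prodset C xb -> dual_solutions AA (prodset C) xs g (stack y) ->
  dfun A C v y = dual_value%:E.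
Proof.
move=> Cxb [Ny gy]; apply/eqP; rewrite eq_le; apply/andP; split; last first.
  by have := dfun_ge y Cxb; rewrite gy !subrr enorm0 dotv0r expr0n mulr0 !addr0.
have -> : dual_value = (1/2) * enorm (AA^T *m stack y - v) ^+ 2
    - (1/2) * enorm v ^+ 2 + dotv (stack y) xb.
  by rewrite dual_value_expansion gy !subrr enorm0 dotv0r expr0n mulr0 !addr0.
rewrite EFinD /dfun tr_mulmx_stack; apply: leeD => //.
rewrite dotv_blocks -sumEFin; apply: lee_sum => i _.
apply: ge_ereal_sup => _ [c Cc <-]; rewrite lee_fin.
have := normal_cone_blocks Cxb Ny Cc; rewrite !stackK dotvBr; lra.
Qed.

Lemma dstar_dual_value (C : forall i, set 'cV[R]_(m i)) :
  prodset C xb -> dual_solutions AA (prodset C) xs g !=set0 ->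
  dstar (dfun A C v) = dual_value%:E.
Proof.
move=> Cxb [s Ss]; apply/eqP; rewrite eq_le; apply/andP; split.
  apply: ereal_inf_lbound; exists (blocks s) => //.
  by apply: dfun_dual_solution; rewrite ?blocksK.
apply: le_ereal_inf_tmp => _ [y _ <-]; apply: le_trans (dfun_ge y Cxb).
by rewrite lee_fin lerDl subrr dotv0r addr0 mulr_ge0 // sqr_ge0.
Qed.

(** At a minimizer the residual plus any pairing is at most 0: the point xb forces the residual to
    vanish, and the other points give normality. *)
Lemma argmin_dual_solutions (C : forall i, set 'cV[R]_(m i)) (y : prodv R m) :
  prodset C xb -> dual_solutions AA (prodset C) xs g !=set0 ->
  argmin (dfun A C v) y <-> dual_solutions AA (prodset C) xs g (stack y).
Proof.
move=> Cxb S0; rewrite /argmin /= (dstar_dual_value Cxb S0); split; last exact: dfun_dual_solution.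
move=> yE; have key c : prodset C c ->
    (1/2) * enorm (AA^T *m stack y - g) ^+ 2 + dotv (stack y) (c - xb) <= 0.
  by move=> /(dfun_ge y); rewrite yE lee_fin gerDl.
split=> [c /key|].
  have := sqr_ge0 (enorm (AA^T *m stack y - g)); lra.
apply/eqP; rewrite -subr_eq0; apply/eqP/enorm_eq0/eqP; rewrite -sqrf_eq0 eq_le sqr_ge0 andbT.
have := key _ Cxb; rewrite subrr dotv0r; lra.
Qed.

Lemma FindicE (C : forall i, set 'cV[R]_(m i)) x :
  Findic A C x = if `[< prodset C (AA *m x) >] then 0%E else +oo%E.
Proof.
rewrite /Findic; case: asboolP => [Cx|/existsNP[i Cx]].
  apply: big1 => i _; rewrite /Defs.indic; case: asboolP => // h; exfalso; apply: h.
  by rewrite /Defs.preim /= -blocks_mulmx.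
rewrite (bigD1 i) //= {1}/Defs.indic; case: asboolP => [h|_].
  by exfalso; apply: Cx; rewrite blocks_mulmx.
rewrite addye // gt_eqF // (lt_le_trans (ltNye 0)) //.
by apply: sume_ge0 => j _; rewrite /Defs.indic; case: ifP.
Qed.

Lemma subdiff_Findic (C : forall i, set 'cV[R]_(m i)) :
  prodset C xb -> subdiff (Findic A C) xs = primal_normal AA (prodset C) xs.
Proof.
move=> Cxb; apply/seteqP; split => h; rewrite /subdiff /= FindicE asboolT //.
  move=> [_ hz] x Cx; have := hz x; rewrite FindicE asboolT //.
  by rewrite add0e lee_fin.
move=> hN; split => // x; rewrite FindicE; case: asboolP => [/hN|_]; last by rewrite leey.
by rewrite add0e lee_fin.
Qed.

End DualFunction.

Theorem theorem4p10 (R : realType) (l n : nat) (m : 'I_l -> nat)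
  (A : forall i : 'I_l, 'M[R]_(m i, n)) (C : forall i : 'I_l, set 'cV[R]_(m i))
  (v xs : 'cV[R]_n) (alpha : R) :
  (1 <= l)%N -> (0 < n)%N -> (forall i, (0 < m i)%N) ->
  (forall i, C i !=set0 /\ closed_e (C i) /\ convex_e (C i)) ->
  (forall i, A i != 0) ->
  (exists x, forall i, C i (A i *m x)) ->
  (* xs is the (unique) solution of min 1/2 |x - v|^2 s.t. A_i x in C_i *)
  (forall i, C i (A i *m xs)) ->
  (forall x, (forall i, C i (A i *m x)) ->
     (1/2) * enorm (xs - v) ^+ 2 <= (1/2) * enorm (x - v) ^+ 2) ->
  0 < alpha -> alpha <= 1 ->
  (* (i) *)
  (forall i, C1a_reducible alpha (C i)) ->
  (* (ii) *)
  (exists x, forall i, ri (C i) (A i *m x)) ->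
  (* (iii) *)
  (exists g, ri (subdiff (Findic A C) xs) g /\ xs - v + g = 0) ->
  exists eps c : R, 0 < eps /\ 0 < c /\
    forall y : prodv R m,
      (pdist y (argmin (dfun A C v)) <= eps%:E)%E ->
      (dstar (dfun A C v) <= dfun A C v y)%E ->
      (dfun A C v y <= dstar (dfun A C v) + eps%:E)%E ->
      (pdist y (argmin (dfun A C v))
         <= (c * powR (fine (dfun A C v y - dstar (dfun A C v))) (1 - 1 / (1 + alpha)))%:E)%E
      /\
      ((powR (fine (dfun A C v y - dstar (dfun A C v))) (1 / (1 + alpha)))%:E
         <= c%:E * pdist (pzero R m) (psubdiff (dfun A C v) y))%E.
Proof.
move=> _ _ _ hC _ _ Cxs _ a0 a1 hred [x0 hx0] [g [gri gE]].
have {}gE : g = v - xs by rewrite -[v - xs]opprB; apply/eqP; rewrite -addr_eq0 addrC gE.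
rewrite {}gE in gri.
pose AA : 'M[R]_(_, n) := \mxcol_i A i.
have Cxb : prodset C (AA *m xs) by move=> i; rewrite blocks_mulmx.
have Ccv i : convex_e (C i) by case: (hC i) => _ [].
have [|T [s0 [M [[Tcl Tcv Tc] [CT [s00 [M0 Tap]]]]]]] := product_tangent_approximation Ccv Cxb a0.
  by move=> i; apply: hred; exact: Cxb.
have rix0 : ri (prodset C) (AA *m x0) by apply: ri_prodset => i; rewrite blocks_mulmx.
rewrite subdiff_Findic // in gri.
have [|S0 [K K0 hK]] := dual_error_bound (g := v - xs) (convex_prodset Ccv) Cxb rix0
  Tcl Tcv Tc CT a0 a1 s00 M0 Tap.
  move=> s Ns; apply: ri_retract => // x _; by rewrite dotv0l.
set d := dfun A C v; set d0 := dual_value v xs.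
have dsE : dstar d = d0%:E by exact: dstar_dual_value.
have argE y : argmin d y <-> dual_solutions AA (prodset C) xs (v - xs) (stack y).
  exact: argmin_dual_solutions.
(* A distance of at most 1/2 is an infimum below 1, so some minimizer lies within the distance 1
   that [dual_error_bound] requires; attainment is not invoked. *)
exists (1 / 2), K; split; first by []; split; first by [].
move=> y yarg _ yle; rewrite holder_exponentE // dsE in yle *.
have [s Ss ys] : exists2 s, dual_solutions AA (prodset C) xs (v - xs) s &
    enorm (stack y - s) <= 1.
  have /ereal_inf_lt[_ [s sarg <-]] : (pdist y (argmin d) < 1%:E)%E.
    by apply: le_lt_trans yarg _; rewrite lte_fin; lra.
  by rewrite lte_fin pnorm_psub => /ltW ys; exists (stack s) => //; apply/argE.
have dge := dfun_ge A v xs y Cxb.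
have [D DE] : exists D, d y = D%:E.
  exists (fine (d y)); rewrite fineK // fin_numElt (lt_le_trans _ dge) ?ltNyr //=.
  by apply: le_lt_trans yle _; rewrite -EFinD ltry.
have fineE : fine (d y - d0%:E) = D - d0 by rewrite DE.
rewrite fineE; set E := D - d0; set theta := alpha / (1 + alpha).
have [||s' Ss' ys'] := hK (stack y) E.
- by exists s.
- move=> c Cc; have := dfun_ge A v xs y Cc; rewrite -/d DE lee_fin -/d0 /E; lra.
have arg' : argmin d (blocks s') by apply/argE; rewrite blocksK.
have pd' : pnorm (psub y (blocks s')) <= K * E `^ theta by rewrite pnorm_psub blocksK.
split.
  apply: ge_ereal_inf; exists (pnorm (psub y (blocks s')))%:E; first by exists (blocks s').
  by rewrite lee_fin.
have E0 : 0 <= E.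
  have := dge; rewrite -/d DE lee_fin subrr dotv0r addr0 -/d0 /E.
  have := sqr_ge0 (enorm (AA^T *m stack y - (v - xs))); rewrite -/AA; lra.
set r := E `^ (1 / (1 + alpha)).
have -> : r%:E = (K%:E * (r / K)%:E)%E by rewrite -EFinM mulrC divfK // gt_eqF.
apply: lee_wpmul2l; first by rewrite lee_fin ltW.
apply: le_ereal_inf_tmp => _ [g' [_ hg'] <-]; rewrite lee_fin ler_pdivrMr //.
have pg : pnorm (psub (pzero R m) g') = enorm (stack g').
  by rewrite pnorm_psub; have -> : stack (pzero R m) = 0; [exact: mxcol0|rewrite sub0r enormN].
rewrite pg.
have [E00|En] := eqVneq E 0.
  by rewrite /r E00 powR0 ?mulr_ge0 ?enorm_ge0 ?(ltW K0) // gt_eqF // divr_gt0 // addr_gt0.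
have Ep : 0 < E by rewrite lt0r En.
have Eth : 0 < E `^ theta by rewrite powR_gt0.
have EE : E = r * E `^ theta.
  rewrite /r -powRD; last by rewrite En implybT.
  have -> : 1 / (1 + alpha) + theta = 1 by rewrite /theta; field; rewrite gt_eqF // addr_gt0.
  by rewrite powRr1.
(* The subgradient inequality at the minimizer s' gives E <= <g', y - s'> <= |g'| K E^theta;
   dividing by E^theta leaves the exponent 1 - theta = 1 / (1 + alpha). *)
have := hg' (blocks s').
have -> : d (blocks s') = d0%:E by rewrite -dsE.
rewrite DE -EFinD lee_fin -dotv_stack stack_sub blocksK => h.
have h1 : E <= enorm (stack g') * (K * E `^ theta).
  apply: (le_trans (y := dotv (stack g') (stack y - s'))).
    by move: h; rewrite !dotvBr /E; lra.
  by rewrite (le_trans (dotv_le_enorm _ _)) // ler_wpM2l ?enorm_ge0.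
by rewrite {1}EE mulrA ler_pM2r in h1.
Qed.
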